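(* Let $1<p<\infty$ and let $g\in C([0,\infty))$ be such that $\lim_{t\to\infty}g(t)=0$. Then there exist an initial datum $0\leq u_0\in L^p(\Omega)$ with $\|u_0\|_{L^p(\Omega)}=1$, and $T>0$, such that $$\|S^\theta(t)u_0\|_{L^p(\Omega)}\geq g(t)\qquad\text{for all } t\geq T.$$
   Context: $\Omega=\mathbb{R}^N\setminus\mathscr{C}$ is a connected exterior domain, where the hole $\mathscr{C}$ is a compact set which is the closure of a bounded smooth open set, $0$ belongs to the interior of $\mathscr{C}$, and $\partial\Omega$ is of class $C^{2,\alpha}$ for some $0<\alpha<1$. The function $\theta:\partial\Omega\to[0,1]$ is of class $C^{1,\alpha}(\partial\Omega)$ and on each connected component of $\partial\Omega$ either $\theta\equiv 0$ (Dirichlet) or $0<\theta\leq 1$ (mixed Neumann/Robin). With $n$ the outward unit normal to $\Omega$, the homogeneous $\theta$-boundary condition is $B_\theta(u)=0$ on $\partial\Omega$, where $B_\theta(u):=\sin(\tfrac{\pi}{2}\theta(x))\frac{\partial u}{\partial n}+\cos(\tfrac{\pi}{2}\theta(x))u$. $S^\theta(t)$ denotes the solution semigroup of $u_t-\Delta u=0$ in $\Omega\times(0,\infty)$, $B_\theta(u)=0$ on $\partial\Omega$, $u(0)=u_0$. For $1<p<\infty$ it is the analytic $C^0$ semigroup of contractions in $L^p(\Omega)$ generated by the Laplacian with domain $\{u\in W^{2,p}(\Omega): B_\theta(u)=0 \text{ on }\partial\Omega\}$; it is given by a positive symmetric kernel $k^\theta$, $S^\theta(t)u_0(x)=\int_\Omega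 k^\theta(x,y,t)u_0(y)\,dy$. *)

(* Defs.v *)
From HB Require Import structures.
From mathcomp Require Export all_boot all_order all_algebra.
From mathcomp Require Export all_classical all_reals all_analysis.

Set Implicit Arguments.
Unset Strict Implicit.
Unset Printing Implicit Defensive.

Export Order.TTheory GRing.Theory Num.Theory numFieldNormedType.Exports.

Local Open Scope classical_set_scope.
Local Open Scope ring_scope.

Definition rV_display : measure_display.
Proof. exact: default_measure_display. Qed.

(* The sigma-algebra on R^n is generated by the coordinates, as the library
   does for tuples; it is the Borel sigma-algebra. *)
Section measurable_rV.
Context (R : realType) (n : nat).

Let coors (i : 'I_n) (x : 'rV[R]_n) : measurableTypeR R := x ord0 i.

Let rV_set0 : g_sigma_preimage coors set0.
Proof. exact: sigma_algebra0. Qed.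

Let rV_setC A : g_sigma_preimage coors A -> g_sigma_preimage coors (~` A).
Proof. exact: sigma_algebraC. Qed.

Let rV_bigcup (F : _^nat) : (forall i, g_sigma_preimage coors (F i)) ->
  g_sigma_preimage coors (\bigcup_i (F i)).
Proof. exact: sigma_algebra_bigcup. Qed.

HB.instance Definition _ :=
  @isMeasurable.Build rV_display
  'rV[R]_n (g_sigma_preimage coors) rV_set0 rV_setC rV_bigcup.

End measurable_rV.

Lemma measurable_rV_coord (R : realType) n (i : 'I_n) :
  measurable_fun [set: 'rV[R]_n]
    (fun x : 'rV[R]_n => x ord0 i : measurableTypeR R).
Proof.
move=> _ Y mY; rewrite setTI; apply: sub_sigma_algebra => /=.
rewrite -bigcup_seq/=; exists i => /=; first by rewrite mem_index_enum.
by exists Y => //; rewrite setTI.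
Qed.

Lemma measurable_fun_rVP (R : realType) d (T : measurableType d) n
    (f : T -> 'rV[R]_n) :
  (forall i, measurable_fun [set: T]
     (fun t => f t ord0 i : measurableTypeR R)) ->
  measurable_fun [set: T] f.
Proof.
move=> mf; have H : g_sigma_preimage (fun (i : 'I_n) (t : T) =>
    f t ord0 i : measurableTypeR R) `<=` measurable.
  apply: smallest_sub; first exact: sigma_algebra_measurable.
  case: n => [|n] in f mf *; first by rewrite big_ord0.
  rewrite -bigcup_mkord_ord; apply: bigcup_sub => i Ii.
  by move=> A [B mB <-]; exact: mf.
move=> _ A mA; apply: H.
have := @g_sigma_preimage_comp _ (measurableTypeR R) n _
  (fun i (x : 'rV[R]_n) => x ord0 i) T f.
by rewrite /comp => ->; exists A.
Qed.

Section lebesgue_rV.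
Context (R : realType).

Definition rV_cons n (t : R) (x : 'rV[R]_n) : 'rV[R]_n.+1 :=
  row_mx (const_mx t : 'rV[R]_1) x.

Lemma measurable_rV_cons n : measurable_fun [set: 'rV[R]_n * measurableTypeR R]
  (fun z => rV_cons z.2 z.1).
Proof.
apply: measurable_fun_rVP => i.
have [j ij|j ij] := @fintype.split_ordP 1 n i.
- have E t x : rV_cons t x ord0 i = t.
    by rewrite ij; apply: (etrans (row_mxEl (const_mx t) x _ _)); rewrite mxE.
  by apply: (eq_measurable_fun snd) => // z _; rewrite E.
- have E t x : rV_cons t x ord0 i = x ord0 j.
    by rewrite ij; exact: (row_mxEr (const_mx t) x).
  apply: (eq_measurable_fun
    ((fun x : 'rV[R]_n => x ord0 j : measurableTypeR R) \o fst)).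
    by move=> z _; rewrite /= E.
  by apply: measurableT_comp => //; exact: measurable_rV_coord.
Qed.

(* The n-dimensional Lebesgue measure: the n-th power of [lebesgue_measure],
   transported to row vectors. *)
Fixpoint lebesgue_rV n : {measure set 'rV[R]_n -> \bar R} :=
  match n with
  | 0 => \d_(0 : 'rV[R]_0)
  | n'.+1 => measure_function_pushforward__canonical__measure_function_Measure
      (lebesgue_rV n' \x lebesgue_measure)%E (measurable_rV_cons (n := n'))
  end.

End lebesgue_rV.

Section hausdorff.
Context (R : realType) (N s : nat).
Local Notation V := 'rV[R]_N.
Local Open Scope ereal_scope.

Definition enorm (x : V) : R := Num.sqrt (\sum_i x ord0 i ^+ 2)%R.

Definition ediam (A : set V) : \bar R :=
  ereal_sup [set r | exists x y, [/\ A x, A y & r = (enorm (x - y))%:E]].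

Definition hausdorff_gauge (delta : R) (A : set V) : \bar R :=
  if `[< A = set0 >] then 0
  else if ediam A <= delta%:E then ediam A ^+ s else +oo.

(* The s-dimensional Hausdorff measure, up to its normalising constant. The
   covers in [mu_ext] are by Borel sets: replacing a set by its closure does not
   change its diameter. *)
Definition hausdorff (A : set V) : \bar R :=
  ereal_sup [set mu_ext (hausdorff_gauge delta) A | delta in [set d : R | 0 < d]%R].

Lemma hausdorff_gauge0 delta : hausdorff_gauge delta set0 = 0.
Proof. by rewrite /hausdorff_gauge; case: asboolP. Qed.

Lemma hausdorff_gauge_ge0 delta A : 0 <= hausdorff_gauge delta A.
Proof.
rewrite /hausdorff_gauge; case: asboolP => // /eqP/set0P[x Ax].
case: ifP => // _; apply: expe_ge0; apply: ereal_sup_ubound.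
exists x, x; split=> //; rewrite subrr /enorm big1 ?sqrtr0// => i _.
by rewrite mxE expr0n.
Qed.

Let H0 : hausdorff set0 = 0.
Proof.
rewrite /hausdorff (_ : [set _ | _ in _] = [set 0]) ?ereal_sup1//.
apply/seteqP; split=> [_ [d _ <-]|_ ->] /=.
  exact: mu_ext0 (hausdorff_gauge0 d) (hausdorff_gauge_ge0 d).
exists 1%R => /=; first by rewrite ltr01.
exact: mu_ext0 (hausdorff_gauge0 _) (hausdorff_gauge_ge0 _).
Qed.

Let Hge0 A : 0 <= hausdorff A.
Proof.
apply: (@le_trans _ _ (mu_ext (hausdorff_gauge 1) A)).
  exact: mu_ext_ge0 (hausdorff_gauge_ge0 1) _.
by apply: ereal_sup_ubound; exists 1%R => //=; rewrite ltr01.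
Qed.

Let Hle : {homo hausdorff : A B / A `<=` B >-> A <= B}.
Proof.
move=> A B AB; apply: ge_ereal_sup => _ [d d0 <-].
apply: (le_trans (le_mu_ext _ AB)).
by apply: ereal_sup_ubound; exists d.
Qed.

Let Hsub : sigma_subadditive hausdorff.
Proof.
move=> F; apply: ge_ereal_sup => _ [d d0 <-].
apply: (le_trans (mu_ext_sigma_subadditive (hausdorff_gauge_ge0 d) F)).
apply: lee_nneseries => [n _ _|n _].
  exact: mu_ext_ge0 (hausdorff_gauge_ge0 d) _.
by apply: ereal_sup_ubound; exists d.
Qed.

HB.instance Definition _ :=
  isOuterMeasure.Build R V hausdorff H0 Hge0 Hle Hsub.

End hausdorff.

Section Lp.
Context (R : realType) (N : nat).
Local Notation V := 'rV[R]_N.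
Local Notation leb := (lebesgue_rV R N).

(* Elements of L^p(Om) are represented by functions on R^N whose values outside
   Om are irrelevant, and are considered modulo [eqae Om]. *)
Definition Lp (Om : set V) (p : R) (u : V -> R) : Prop :=
  u \_ Om \in Lfun leb p%:E.

Definition normLp (Om : set V) (p : R) (u : V -> R) : \bar R :=
  ('N[leb]_p%:E[EFin \o (u \_ Om)])%E.

Definition eqae (Om : set V) (u v : V -> R) : Prop :=
  {ae leb, forall x, Om x -> u x = v x}.

End Lp.

Section classes.
Context (R : realType).

Definition partial n (i : 'I_n) (f : 'rV[R]_n -> R) : 'rV[R]_n -> R :=
  fun x => 'D_(delta_mx ord0 i) f x.

Definition gradient n (f : 'rV[R]_n -> R) (x : 'rV[R]_n) : 'rV[R]_n :=
  \row_i partial i f x.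

(* All partial derivatives of order less than k are continuous, those of order k
   exist and satisfy P. *)
Fixpoint diff_class n (P : ('rV[R]_n -> R) -> Prop) k (f : 'rV[R]_n -> R) : Prop :=
  match k with
  | 0 => P f
  | k'.+1 => [/\ continuous f,
                 forall i x, derivable f x (delta_mx ord0 i) &
                 forall i, diff_class P k' (partial i f)]
  end.

Definition Ck n (k : nat) : ('rV[R]_n -> R) -> Prop :=
  diff_class (fun h => continuous h) k.

Definition smooth n (f : 'rV[R]_n -> R) : Prop := forall k, Ck k f.

Definition holder n (alpha : R) (f : 'rV[R]_n -> R) : Prop :=
  exists C : R, forall x y, `|f x - f y| <= C * `|x - y| `^ alpha.

(* C^{k,alpha}: no bound on f itself is asked, as only local properties of the
   charts below matter. *)
Definition holder_class n (k : nat) (alpha : R) : ('rV[R]_n -> R) -> Prop :=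
  diff_class (holder alpha) k.

Definition test_function n (Om : set 'rV[R]_n) (phi : 'rV[R]_n -> R) : Prop :=
  [/\ smooth phi, compact (closure [set x | phi x != 0]) &
      closure [set x | phi x != 0] `<=` Om].

End classes.

Section domains.
Context (R : realType) (N : nat).
Local Notation V := 'rV[R]_N.

Definition boundary (A : set V) : set V := closure A `\` A°.

(* Up to the choice of an axis i and of an orientation b, a domain lies locally
   on the side of the graph of gamma where [graph_side] is negative. *)
Definition graph_side (i : 'I_N) (b : bool) (gamma : 'rV[R]_N.-1 -> R) (x : V) : R :=
  (-1) ^+ b * (x ord0 i - gamma (col' i x)).

Definition local_graph (Om : set V) (x : V) (r : R) i b gamma : Prop :=
  0 < r /\ forall y, ball x r y -> (Om y <-> graph_side i b gamma y < 0).

Definition holder_domain (k : nat) (alpha : R) (Om : set V) : Prop :=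
  forall x, boundary Om x -> exists r i b gamma,
    holder_class k alpha gamma /\ local_graph Om x r i b gamma.

(* A function on the boundary is C^{1,alpha} when it is so in graph coordinates. *)
Definition holder1_boundary (alpha : R) (Om : set V) (theta : V -> R) : Prop :=
  forall x, boundary Om x -> exists r i b gamma h,
    [/\ holder_class 2 alpha gamma, local_graph Om x r i b gamma,
        holder_class 1 alpha h &
        forall y, boundary Om y -> ball x r y -> theta y = h (col' i y)].

Definition outward_unit_normal (Om : set V) (x nu : V) : Prop :=
  exists r i b gamma,
    [/\ Ck 1 gamma, local_graph Om x r i b gamma &
        nu = (enorm (gradient (graph_side i b gamma) x))^-1 *:
             gradient (graph_side i b gamma) x].

Definition exterior_domain (alpha : R) (hole : set V) : Prop :=
  [/\ compact hole,
      exists D, [/\ open D, bounded_set D, holder_domain 2 alpha D &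
                    hole = closure D],
      hole° 0,
      connected (~` hole) &
      holder_domain 2 alpha (~` hole)].

Definition theta_datum (alpha : R) (Om : set V) (theta : V -> R) : Prop :=
  [/\ forall x, boundary Om x -> 0 <= theta x <= 1,
      holder1_boundary alpha Om theta &
      forall x, boundary Om x ->
        (forall y, connected_component (boundary Om) x y -> theta y = 0) \/
        (forall y, connected_component (boundary Om) x y -> 0 < theta y <= 1)].

End domains.

Section sobolev.
Context (R : realType) (N : nat) (Om : set 'rV[R]_N) (p : R).
Local Notation V := 'rV[R]_N.
Local Notation leb := (lebesgue_rV R N).

(* v is the weak i-th partial derivative of u, both being in L^p(Om). *)
Definition weak_partial (i : 'I_N) (u v : V -> R) : Prop :=
  [/\ Lp Om p u, Lp Om p v & forall phi, test_function Om phi ->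
      \int[leb]_(x in Om) (u x * partial i phi x) =
      - \int[leb]_(x in Om) (v x * phi x)].

Fixpoint sobolev (k : nat) (u : V -> R) : Prop :=
  match k with
  | 0 => Lp Om p u
  | k'.+1 => Lp Om p u /\
             forall i, exists2 v, weak_partial i u v & sobolev k' v
  end.

Definition weak_laplacian (u f : V -> R) : Prop :=
  exists du ddu : 'I_N -> V -> R,
    [/\ forall i, weak_partial i u (du i),
        forall i, weak_partial i (du i) (ddu i) &
        eqae Om f (fun x => \sum_i ddu i x)].

Definition surf : {outer_measure set V -> \bar R} := @hausdorff R N N.-1.

(* The surface measure on the boundary is the restriction of the
   (N-1)-dimensional Hausdorff measure. *)
Definition surface_measure : {measure set (caratheodory_type surf) -> \bar R} :=
  [the measure _ _ of (surf : set (caratheodory_type surf) -> \bar R)].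

(* w is the trace of u, which is in W^{1,p}(Om): extension by continuity
   of the restriction to the boundary, from C_c^oo(R^N) to W^{1,p}(Om). *)
Definition trace (u w : V -> R) : Prop :=
  exists (phi : nat -> V -> R) (du : 'I_N -> V -> R),
  [/\ w \_ (boundary Om) \in Lfun surface_measure p%:E,
      forall i, weak_partial i u (du i),
      forall k, test_function [set: V] (phi k) &
  [/\ normLp Om p (fun x => phi k x - u x) @[k --> \oo] --> 0%E,
      forall i, normLp Om p (fun x => partial i (phi k) x - du i x)
        @[k --> \oo] --> 0%E &
      ('N[surface_measure]_p%:E
        [EFin \o ((fun x => phi k x - w x)%R \_ (boundary Om))])%E
        @[k --> \oo] --> 0%E]].

(* B_theta(u) = 0 on the boundary, in the sense of traces, where w0 and w are the
   traces of u and of its gradient, and n is the outward unit normal. *)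
Definition boundary_condition (theta u : V -> R) : Prop :=
  exists (n : V -> V) (w0 : V -> R) (w : 'I_N -> V -> R),
  [/\ forall x, boundary Om x -> outward_unit_normal Om x (n x),
      trace u w0,
      forall i, exists2 v, weak_partial i u v & trace v (w i) &
      {ae surface_measure, forall x, boundary Om x ->
        sin (pi / 2 * theta x) * (\sum_i n x ord0 i * w i x) +
        cos (pi / 2 * theta x) * w0 x = 0}].

(* The graph of the Laplacian in L^p(Om) with the theta-boundary condition. *)
Definition theta_laplacian (theta u f : V -> R) : Prop :=
  [/\ sobolev 2 u, boundary_condition theta u & weak_laplacian u f].

End sobolev.

Section semigroups.
Context (R : realType) (N : nat) (Om : set 'rV[R]_N) (p : R).
Local Notation V := 'rV[R]_N.
Local Notation leb := (lebesgue_rV R N).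
Implicit Type S : R -> (V -> R) -> (V -> R).

Definition linear_Lp (A : (V -> R) -> (V -> R)) : Prop :=
  (forall u, Lp Om p u -> Lp Om p (A u)) /\
  (forall (c : R) u v, Lp Om p u -> Lp Om p v ->
     eqae Om (A (fun x => c * u x + v x)) (fun x => c * A u x + A v x)).

Definition bounded_Lp (A : (V -> R) -> (V -> R)) : Prop :=
  linear_Lp A /\ exists M : R, forall u, Lp Om p u ->
    (normLp Om p (A u) <= M%:E * normLp Om p u)%E.

Definition C0_contraction_semigroup S : Prop :=
  [/\ forall t, 0 <= t -> linear_Lp (S t),
      forall u, Lp Om p u -> eqae Om (S 0 u) u,
      forall s t u, 0 <= s -> 0 <= t -> Lp Om p u ->
        eqae Om (S (s + t) u) (S s (S t u)),
      forall t u, 0 <= t -> Lp Om p u -> (normLp Om p (S t u) <= normLp Om p u)%E &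
      forall u, Lp Om p u ->
        normLp Om p (fun x => S t u x - u x) @[t --> 0^'+] --> 0%E].

Definition sector (delta : R) (a b : R) : Prop := 0 < a /\ `|b| < delta * a.

(* S extends to a holomorphic semigroup of bounded operators on L^p(Om; C), on a
   complex sector around the positive half-line. The extension at a + ib maps a
   real u to X a b u + i Y a b u, and acts on complex functions by C-linearity.
   The complex derivative at a + ib, applied to u, is P + iQ. *)
Definition analytic_semigroup S : Prop :=
  exists2 delta : R, 0 < delta & exists X Y : R -> R -> (V -> R) -> (V -> R),
  [/\ forall a b, sector delta a b -> bounded_Lp (X a b) /\ bounded_Lp (Y a b),
      forall t u, 0 < t -> Lp Om p u ->
        eqae Om (X t 0 u) (S t u) /\ eqae Om (Y t 0 u) (fun=> 0),
      forall a b c d u, sector delta a b -> sector delta c d -> Lp Om p u ->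
        eqae Om (X (a + c) (b + d) u)
          (fun x => X a b (X c d u) x - Y a b (Y c d u) x) /\
        eqae Om (Y (a + c) (b + d) u)
          (fun x => X a b (Y c d u) x + Y a b (X c d u) x),
      forall a b u, sector delta a b -> Lp Om p u ->
        exists P Q : V -> R, [/\ Lp Om p P, Lp Om p Q &
        forall eps : R, 0 < eps -> exists2 r : R, 0 < r &
        forall h k : R, `|h| < r -> `|k| < r ->
          (normLp Om p (fun x =>
             X (a + h) (b + k) u x - X a b u x - (h * P x - k * Q x))%R
           <= (eps * (`|h| + `|k|))%:E)%E /\
          (normLp Om p (fun x =>
             Y (a + h) (b + k) u x - Y a b u x - (h * Q x + k * P x))%R
           <= (eps * (`|h| + `|k|))%:E)%E] &
      forall u, Lp Om p u -> forall eps : R, 0 < eps -> exists2 r : R, 0 < r &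
        forall a b, sector delta a b -> a < r ->
          (normLp Om p (fun x => X a b u x - u x)%R <= eps%:E)%E /\
          (normLp Om p (Y a b u) <= eps%:E)%E].

Definition generated_by S (A : (V -> R) -> (V -> R) -> Prop) : Prop :=
  forall u f, Lp Om p u -> Lp Om p f ->
    (A u f <->
     normLp Om p (fun x => h^-1 * (S h u x - u x) - f x) @[h --> 0^'+] --> 0%E).

Definition has_positive_symmetric_kernel S : Prop :=
  exists k : V -> V -> R -> R,
  (forall x y t, Om x -> Om y -> 0 < t -> 0 < k x y t /\ k x y t = k y x t) /\
  (forall t u, 0 < t -> Lp Om p u ->
     {ae leb, forall x, Om x ->
        leb.-integrable Om (fun y => (k x y t * u y)%:E) /\
        S t u x = \int[leb]_(y in Om) (k x y t * u y)}).

Definition theta_semigroup (theta : V -> R) S : Prop :=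
  [/\ C0_contraction_semigroup S,
      analytic_semigroup S,
      generated_by S (theta_laplacian Om p theta) &
      has_positive_symmetric_kernel S].

End semigroups.

(* Main.v *)
From HB Require Import structures.
From mathcomp Require Import measurable_realfun ring lra.
Require Import Defs.

Set Implicit Arguments.
Unset Strict Implicit.
Unset Printing Implicit Defensive.
Local Open Scope classical_set_scope.
Local Open Scope ring_scope.

(** An orbit can decay arbitrarily slowly because the exterior domain contains
    arbitrarily large boxes, and a smooth bump spread over a box of side [r]
    hardly evolves during times much smaller than [r ^+ 2].

    The quantitative form of this remark is [semigroup_drift]: if the generator
    maps [u] to [f], then contractivity gives [|S t u - u| <= t |f|], by cutting
    [0, t] into n steps and letting n grow. A bump supported in the interior of
    the domain satisfies every boundary condition of the family, since it
    vanishes near the boundary, so it lies in the domain of the generator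
    ([bump_theta_laplacian]). Its Laplacian has size [r ^- 2] relative to the
    bump itself; hence, for every T, a bump with [r] large enough keeps half of
    its norm up to time T ([wave_packets]).

    These packets are then superposed ([slow_decay]). Let [tau k] be times after
    which [g <= 2 ^- (k + 2)], and let [u k] be a nonnegative packet of norm 1
    which keeps half of its norm up to time [tau (k + 1)]. The datum is the sum
    of the [2 ^- (k + 1) u k]. The kernel being positive, the orbit of the sum
    dominates the orbit of each term, so that its norm is at least
    [2 ^- (k + 2)] for t between [tau k] and [tau (k + 1)]. The datum has norm
    at most 1, and normalising it can only enlarge the orbit.

    What remains is calculus on R^n for the product Lebesgue measure: the weak
    derivatives of a bump are the classical ones ([integral_by_parts]), which
    Fubini reduces to the fundamental theorem of calculus on lines
    ([integral_lines0]). *)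

(** * The seminorm of L^p of a domain *)

Section Lp_seminorm.
Context (R : realType) (N : nat) (Om : set 'rV[R]_N) (p : R) (p_gt1 : 1 < p).
Local Notation V := 'rV[R]_N.
Local Notation leb := (lebesgue_rV R N).
Local Notation Lp := (Lp Om p).
Local Notation normLp := (normLp Om p).

Let p1 : (1 <= p%:E)%E. Proof. by rewrite lee_fin ltW. Qed.
Let p0 : 0 < p. Proof. exact: lt_trans p_gt1. Qed.

Lemma Lp_measurable u : Lp u -> measurable_fun [set: V] (u \_ Om).
Proof. by move=> /sub_Lfun_mfun; rewrite inE. Qed.

Lemma Lp_lincomb c u v : Lp u -> Lp v -> Lp (fun x => c * u x + v x).
Proof.
rewrite /Defs.Lp => hu hv.
rewrite (_ : _ \_ _ = c *: (u \_ Om) + v \_ Om).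
  by have [_] := Lfun_submod_closed leb p1; apply.
apply/funext => x; transitivity (c * (u \_ Om) x + (v \_ Om) x); last by [].
by rewrite /patch; case: ifP => // _; rewrite mulr0 addr0.
Qed.

Lemma Lp0 : Lp (fun=> 0).
Proof.
rewrite /Defs.Lp (_ : _ \_ _ = 0).
  by have [] := Lfun_submod_closed leb p1.
by apply/funext => x; rewrite /patch; case: ifP.
Qed.

Lemma LpZ c u : Lp u -> Lp (fun x => c * u x).
Proof.
move=> hu; have := Lp_lincomb c hu Lp0.
by under [X in Lp X]eq_fun do rewrite addr0.
Qed.

Lemma LpB u v : Lp u -> Lp v -> Lp (fun x => u x - v x).
Proof.
move=> hu hv; have := Lp_lincomb (-1) hv hu.
by under [X in Lp X]eq_fun do rewrite mulN1r addrC.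
Qed.

Lemma LpD u v : Lp u -> Lp v -> Lp (fun x => u x + v x).
Proof.
move=> hu hv; have := Lp_lincomb 1 hu hv.
by under [X in Lp X]eq_fun do rewrite mul1r.
Qed.

Lemma normLp_ge0 u : (0 <= normLp u)%E.
Proof. exact: Lnorm_ge0. Qed.

Lemma normLp_fin u : Lp u -> normLp u \is a fin_num.
Proof.
move=> /sub_Lfun_finLfun; rewrite inE /= => h.
by rewrite ge0_fin_numE// normLp_ge0.
Qed.

Lemma normLpD u v : Lp u -> Lp v ->
  (normLp (fun x => u x + v x)%R <= normLp u + normLp v)%E.
Proof.
move=> hu hv; rewrite /Defs.normLp.
rewrite [X in ('N[_]_ _ [X] <= _)%E](_ : _ = EFin \o ((u \_ Om) \+ (v \_ Om))).
  by apply: eminkowski => //; exact: Lp_measurable.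
apply/funext => x; rewrite /patch /=.
by case: ifP => // _; rewrite addr0.
Qed.

Lemma normLpZ c u : Lp u -> normLp (fun x => c * u x) = (`|c|%:E * normLp u)%E.
Proof.
move=> hu; rewrite /Defs.normLp -(LnormZ (Lfun_Sub p1 hu)); congr Lnorm.
apply/funext => x; rewrite /patch /=.
by case: ifP => //= _; rewrite /GRing.scale/= mulr0.
Qed.

Lemma normLp0 : normLp (fun=> 0) = 0%E.
Proof.
rewrite (_ : (fun=> 0) = fun x : V => 0 * (fun=> 0) x).
  by rewrite (normLpZ _ Lp0) normr0 mul0e.
by apply/funext => x; rewrite mul0r.
Qed.

(** Only the values on [Om], up to a null set, are compared: this is how the
    semigroup, known only modulo [eqae Om], is controlled. *)
Lemma le_normLp_ae u v : Lp u -> Lp v ->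
  {ae leb, forall x, Om x -> `|u x| <= `|v x|} -> (normLp u <= normLp v)%E.
Proof.
move=> hu hv huv; rewrite /Defs.normLp unlock.
have h w : Lp w -> measurable_fun [set: V]
    (fun x => `|(EFin \o w \_ Om) x| `^ p : \bar R)%E.
  move=> hw; apply: (measurableT_comp (measurable_poweR p)).
  apply: measurableT_comp => //; apply: measurableT_comp => //.
  exact: Lp_measurable.
apply: gt0_ler_poweR.
- by rewrite invr_ge0 ltW.
- by rewrite in_itv/= leey andbT integral_ge0// => x _; exact: poweR_ge0.
- by rewrite in_itv/= leey andbT integral_ge0// => x _; exact: poweR_ge0.
apply: ae_ge0_le_integral => //.
- by move=> x _; exact: poweR_ge0.
- exact: h.
- by move=> x _; exact: poweR_ge0.
- exact: h.
apply: filterS huv => x hx _.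
apply: gt0_ler_poweR; first exact: ltW.
- by rewrite in_itv/= leey andbT lee_fin.
- by rewrite in_itv/= leey andbT lee_fin.
rewrite /= lee_fin /patch; case: ifPn => [|_]; last by rewrite normr0.
by rewrite inE => /hx.
Qed.

Lemma eq_normLp_ae u v : Lp u -> Lp v -> eqae Om u v -> normLp u = normLp v.
Proof.
move=> hu hv uv; apply/eqP; rewrite eq_le; apply/andP; split;
  by apply: le_normLp_ae => //; apply: filterS uv => x /[apply] ->.
Qed.

Lemma normLpB_ge u v : Lp u -> Lp v ->
  (normLp u <= normLp v + normLp (fun x => v x - u x)%R)%E.
Proof.
move=> hu hv; rewrite -[X in (_ <= _ + X)%E](_ : normLp (fun x => u x - v x)%R = _).
  apply: le_trans (normLpD hv (LpB hu hv)).
  rewrite [X in (_ <= normLp X)%E](_ : _ = u)//.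
  by apply/funext => x; rewrite addrC subrK.
rewrite (_ : (fun x => u x - v x) = (fun x => -1 * (v x - u x))).
  by rewrite (normLpZ _ (LpB hv hu)) normrN1 mul1e.
by apply/funext => x; rewrite mulN1r opprB.
Qed.

End Lp_seminorm.

(** * Contraction semigroups: drift, monotonicity *)

Section semigroup_drift.
Context (R : realType) (N : nat) (Om : set 'rV[R]_N) (p : R) (p_gt1 : 1 < p).
Local Notation V := 'rV[R]_N.
Local Notation Lp := (Lp Om p).
Local Notation normLp := (normLp Om p).
Context (S : R -> (V -> R) -> V -> R) (hS : C0_contraction_semigroup Om p S).

Lemma semigroup_Lp t u : 0 <= t -> Lp u -> Lp (S t u).
Proof. by have [h _ _ _ _] := hS => t0; have [+ _] := h t t0; apply. Qed.

Lemma semigroupB t u v : 0 <= t -> Lp u -> Lp v ->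
  eqae Om (S t (fun x => u x - v x)) (fun x => S t u x - S t v x).
Proof.
have [h _ _ _ _] := hS => t0 hu hv; have [_ /(_ (-1) v u hv hu)] := h t t0.
rewrite (_ : (fun x => -1 * v x + u x) = (fun x => u x - v x)); last first.
  by apply/funext => x; rewrite mulN1r addrC.
by apply: filterS => x /[apply] ->; rewrite mulN1r addrC.
Qed.

(** Telescoping along the multiples of [h]: each increment of the orbit is the
    image by a contraction of the first one. *)
Lemma semigroup_drift_iter h u n : 0 <= h -> Lp u ->
  (normLp (fun x => S (n%:R * h) u x - u x)%R
    <= n%:R%:E * normLp (fun x => S h u x - u x)%R)%E.
Proof.
move=> h0 hu; have [_ S0 SD Sc _] := hS.
have hB : Lp (fun x => S h u x - u x) by apply: LpB => //; exact: semigroup_Lp.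
have tp k : 0 <= k%:R * h by rewrite mulr_ge0.
elim: n => [|n IH].
  rewrite mul0r mul0e (eq_normLp_ae p_gt1 _ (Lp0 Om p_gt1)).
  - by rewrite normLp0.
  - by apply: LpB => //; exact: semigroup_Lp.
  - by apply: filterS (S0 u hu) => x /[apply] ->; rewrite subrr.
rewrite -natr1 mulrDl mul1r.
have hn := semigroup_Lp (tp n) hu; have hh := semigroup_Lp h0 hu.
have E : eqae Om (fun x => S (n%:R * h + h) u x - u x)
    (fun x => (S (n%:R * h) u x - u x) +
              S (n%:R * h) (fun x => S h u x - u x) x).
  have := SD _ _ _ (tp n) h0 hu; have := semigroupB (tp n) hh hu.
  apply: filterS2 => x H1 H2 Ox; rewrite H1// H2//.
  by rewrite [RHS]addrC subrKA.
have L1 := LpB p_gt1 hn hu; have L2 := semigroup_Lp (tp n) hB.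
rewrite (eq_normLp_ae p_gt1 _ (LpD p_gt1 L1 L2) E); last first.
  by apply: LpB => //; apply: semigroup_Lp => //; rewrite addr_ge0.
apply: (le_trans (normLpD p_gt1 L1 L2)).
rewrite EFinD ge0_muleDl// mul1e leeD//.
exact: Sc.
Qed.

(** The right derivative at 0 bounds the whole displacement. By
    [semigroup_drift_iter], cutting [0, t] into equal steps of length [h] costs
    at most t times the difference quotient at [h], whose norm tends to that of
    [f]; the semigroup is never integrated in time. *)
Lemma semigroup_drift u f t : Lp u -> Lp f -> 0 <= t ->
  normLp (fun x => h^-1 * (S h u x - u x) - f x) @[h --> 0^'+] --> 0%E ->
  (normLp (fun x => S t u x - u x)%R <= t%:E * normLp f)%E.
Proof.
move=> hu hf; rewrite le_eqVlt => /predU1P[<- _|t0 hlim].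
  have := semigroup_drift_iter 0 (lexx 0) hu; rewrite mul0r => /le_trans; apply.
  by rewrite !mul0e.
apply/lee_addgt0Pr => _/posnumP[e].
have et0 : 0 < e%:num / t by rewrite divr_gt0.
have [d /= d0 hd] : \forall h \near 0^'+,
    (normLp (fun x => h^-1 * (S h u x - u x) - f x)%R < (e%:num / t)%:E)%E.
  apply: (hlim [set y | (y < (e%:num / t)%:E)%E]).
  by apply: open_nbhs_nbhs; split; [exact: open_ereal_lt_ereal|rewrite /= lte_fin].
(* The step t / (n + 1) is smaller than the radius [d] found above. *)
pose n := Num.truncn (t / d).
pose h := t / n.+1%:R.
have h0 : 0 < h by rewrite divr_gt0.
have hlt : h < d.
  rewrite /h ltr_pdivrMr// mulrC -ltr_pdivrMr//.
  exact: truncnS_gt.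
have {hd}hd : (normLp (fun x => h^-1 * (S h u x - u x) - f x)%R < (e%:num / t)%:E)%E.
  by apply: hd => //=; rewrite sub0r normrN gtr0_norm.
have -> : t = n.+1%:R * h by rewrite /h mulrC divfK// pnatr_eq0.
apply: (le_trans (semigroup_drift_iter _ (ltW h0) hu)).
have hB : Lp (fun x => S h u x - u x).
  by apply: LpB => //; apply: semigroup_Lp => //; exact: ltW.
rewrite (_ : (fun x => S h u x - u x) =
  (fun x => h * ((h^-1 * (S h u x - u x) - f x) + f x))); last first.
  by apply/funext => x; rewrite subrK mulrA divff ?mul1r// gt_eqF.
have L1 : Lp (fun x => h^-1 * (S h u x - u x) - f x).
  by apply: LpB => //; exact: LpZ.
rewrite normLpZ//; last exact: LpD.
rewrite gtr0_norm// muleA -EFinM -(_ : t = n.+1%:R * h); last first.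
  by rewrite /h mulrC divfK// pnatr_eq0.
rewrite -(fineK (normLp_fin hf)).
apply: (@le_trans _ _ (t%:E * ((e%:num / t)%:E + normLp f))%E).
  apply: lee_wpmul2l; first by rewrite lee_fin ltW.
  apply: (le_trans (normLpD p_gt1 L1 hf)); apply: leeD => //; exact: ltW.
rewrite -(fineK (normLp_fin hf)) -EFinD -!EFinM -EFinD lee_fin mulrDr.
by rewrite mulrC divfK ?gt_eqF// addrC.
Qed.

Lemma norm_semigroup_ge u f t : Lp u -> Lp f -> 0 <= t ->
  normLp (fun x => h^-1 * (S h u x - u x) - f x) @[h --> 0^'+] --> 0%E ->
  (normLp u <= normLp (S t u) + t%:E * normLp f)%E.
Proof.
move=> hu hf t0 hlim.
have hSt := semigroup_Lp t0 hu.
apply: (le_trans (normLpB_ge p_gt1 hu hSt)); apply: leeD => //.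
exact: semigroup_drift.
Qed.

Lemma norm_semigroup_le s t u : 0 <= s -> s <= t -> Lp u ->
  (normLp (S t u) <= normLp (S s u))%E.
Proof.
have [_ _ SD Sc _] := hS => s0 st hu.
have ts0 : 0 <= t - s by rewrite subr_ge0.
have hs := semigroup_Lp s0 hu.
rewrite -(subrK s t) (eq_normLp_ae p_gt1 _ _ (SD _ _ _ ts0 s0 hu)).
- exact: Sc.
- by apply: semigroup_Lp => //; rewrite addr_ge0.
- exact: semigroup_Lp.
Qed.

End semigroup_drift.

Section positivity.
Context (R : realType) (N : nat) (Om : set 'rV[R]_N) (p : R) (p_gt1 : 1 < p).
Local Notation V := 'rV[R]_N.
Local Notation leb := (lebesgue_rV R N).
Context (S : R -> (V -> R) -> V -> R).
Context (hS : C0_contraction_semigroup Om p S)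
  (hk : has_positive_symmetric_kernel Om p S).

Lemma semigroup_ge0 t u : 0 < t -> Lp Om p u -> (forall x, Om x -> 0 <= u x) ->
  {ae leb, forall x, Om x -> 0 <= S t u x}.
Proof.
move=> t0 hu u0; have [k [k0 kS]] := hk.
apply: filterS (kS t u t0 hu) => x h Ox; have [_ ->] := h Ox.
rewrite /Rintegral fine_ge0// integral_ge0// => y Oy.
by rewrite lee_fin mulr_ge0 ?u0// ltW//; have [] := k0 x y t Ox Oy t0.
Qed.

Lemma semigroup_norm_mono t u v : 0 < t -> Lp Om p u -> Lp Om p v ->
  (forall x, Om x -> 0 <= u x <= v x) ->
  (normLp Om p (S t u) <= normLp Om p (S t v))%E.
Proof.
move=> t0 hu hv uv; have t0' := ltW t0.
apply: le_normLp_ae => //; try exact: (semigroup_Lp hS).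
have := semigroup_ge0 t0 hu (fun x Ox => proj1 (andP (uv x Ox))).
have : {ae leb, forall x, Om x -> 0 <= S t (fun x => v x - u x) x}.
  apply: semigroup_ge0 => //; first exact: LpB.
  by move=> x /uv/andP[_]; rewrite subr_ge0.
have := semigroupB hS t0' hv hu.
apply: filterS3 => x H1 H2 H3 Ox.
move: (H2 Ox); rewrite H1// subr_ge0 => H4.
by rewrite !ger0_norm ?H3// (le_trans (H3 Ox)).
Qed.

End positivity.

(** * Slowly decaying orbits from slowly evolving packets *)

Section Lp_monotone_limit.
Context (R : realType) (N : nat) (Om : set 'rV[R]_N) (p : R) (p_gt1 : 1 < p).
Local Notation V := 'rV[R]_N.
Local Notation leb := (lebesgue_rV R N).
Let p0 : 0 < p. Proof. exact: lt_trans p_gt1. Qed.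

(** At positive points the power function is continuous, being differentiable; at
    0 the bound by the limit makes the sequence constant. *)
Lemma powR_cvg_nat (a : R^nat) (l : R) : (forall n, 0 <= a n <= l) ->
  a n @[n --> \oo] --> l -> a n `^ p @[n --> \oo] --> l `^ p.
Proof.
move=> al acv; have l0 : 0 <= l by have /andP[/le_trans] := al 0; apply.
have [l00|ln0] := eqVneq l 0.
  rewrite (_ : (fun n => _) = cst (l `^ p)); first exact: cvg_cst.
  by apply/funext => n; have := al n; rewrite l00 -eq_le => /eqP <-.
have lp : 0 < l by rewrite lt_neqAle eq_sym ln0.
have : {for l, continuous (fun x : R => x `^ p)}.
  apply: differentiable_continuous; apply/derivable1_diffP.
  by apply: derivable_powR; rewrite in_itv/= lp.
by move=> cont; exact: continuous_cvg cont acv.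
Qed.

(** Fatou's lemma, which gives the membership in L^p of the pointwise limit
    without the completeness of L^p. *)
Lemma Lp_monotone_limit (s : nat -> V -> R) (u : V -> R) (M : R) : 0 <= M ->
  (forall n, Lp Om p (s n)) -> (forall n, (normLp Om p (s n) <= M%:E)%E) ->
  (forall n x, 0 <= s n x <= u x) ->
  (forall x, s n x @[n --> \oo] --> u x) ->
  Lp Om p u /\ (normLp Om p u <= M%:E)%E.
Proof.
move=> M0 hs sM su cv.
have cvO x : (s n \_ Om) x @[n --> \oo] --> (u \_ Om) x.
  rewrite /patch; case: (x \in Om) => //; exact: cvg_cst.
have su' n x : 0 <= (s n \_ Om) x <= (u \_ Om) x.
  by rewrite /patch; case: (x \in Om) => //; rewrite lexx.
have mu : measurable_fun [set: V] (u \_ Om).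
  apply: (@measurable_fun_cvg _ _ _ _ (fun n => s n \_ Om)) => // m.
  exact: Lp_measurable.
have sn n : (\int[leb]_x (`|(EFin \o s n \_ Om) x| `^ p) <= (M `^ p)%:E)%E.
  rewrite -poweR_Lnorm ?gt_eqF// -poweR_EFin; apply: gt0_ler_poweR.
  - exact: ltW.
  - by rewrite in_itv/= leey andbT; exact: Lnorm_ge0.
  - by rewrite in_itv/= leey andbT lee_fin.
  - exact: sM.
have normu : (normLp Om p u <= M%:E)%E.
  rewrite /normLp unlock.
  rewrite -[leRHS](_ : (M `^ p)%:E `^ p^-1 = _)%E; last first.
    by rewrite poweR_EFin -powRrM mulfV ?powRr1// gt_eqF.
  apply: gt0_ler_poweR.
  - by rewrite invr_ge0 ltW.
  - by rewrite in_itv/= leey andbT integral_ge0// => x _; exact: poweR_ge0.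
  - by rewrite in_itv/= leey andbT lee_fin powR_ge0.
  pose f n x := (`|(EFin \o s n \_ Om) x| `^ p : \bar R)%E.
  have fc x : f n x @[n --> \oo] --> (`|(EFin \o u \_ Om) x| `^ p)%E.
    have E (w : V -> R) : 0 <= (w \_ Om) x ->
        (`|(EFin \o w \_ Om) x| `^ p = ((w \_ Om) x `^ p)%:E)%E.
      by move=> w0; rewrite gee0_abs ?lee_fin// -poweR_EFin.
    rewrite (E u); last by have /andP[/le_trans h /h] := su' 0%N x.
    rewrite (_ : f ^~ x = fun n => ((s n \_ Om) x `^ p)%:E); last first.
      by apply/funext => n; rewrite /f E//; have /andP[] := su' n x.
    apply: cvg_EFin; first by apply: nearW.
    by apply: powR_cvg_nat (cvO x) => n; exact: su'.
  rewrite (eq_integral (fun x => limn_einf (f^~ x))); last first.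
    by move=> x _; rewrite (cvg_limn_einf_sup (fc x)).1.
  apply: (le_trans (fatou leb measurableT _ _)).
  - move=> n; apply: (measurableT_comp (measurable_poweR p)).
    apply: measurableT_comp => //; apply: measurableT_comp => //.
    exact: Lp_measurable.
  - by move=> n x _; exact: poweR_ge0.
  rewrite limn_einf_lim; apply: lime_le; first exact: is_cvg_einfs.
  apply: nearW => n; apply: (le_trans _ (sn n)).
  by apply: ereal_inf_lbound; exists n => //=.
split => //; rewrite /Lp; apply/andP; split; rewrite inE//=.
by rewrite /finite_norm (le_lt_trans normu)// ltry.
Qed.

End Lp_monotone_limit.

Section slow_decay.
Context (R : realType) (N : nat) (Om : set 'rV[R]_N) (p : R) (p_gt1 : 1 < p).
Local Notation V := 'rV[R]_N.
Local Notation leb := (lebesgue_rV R N).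
Local Notation Lp := (Lp Om p).
Local Notation normLp := (normLp Om p).
Context (S : R -> (V -> R) -> V -> R).
Context (hS : C0_contraction_semigroup Om p S)
  (hk : has_positive_symmetric_kernel Om p S).

Lemma semigroupZ t c u : 0 <= t -> Lp u ->
  eqae Om (S t (fun x => c * u x)) (fun x => c * S t u x).
Proof.
move=> t0 hu; have [h _ _ _ _] := hS.
have [_ hlin] := h t t0.
(* The zero function is written [u - u], to get its image from [semigroupB]. *)
have E0 := semigroupB hS t0 hu hu.
have := hlin c u _ hu (LpB p_gt1 hu hu).
rewrite (_ : (fun x => c * u x + (u x - u x)) = (fun x => c * u x)); last first.
  by apply/funext => x; rewrite subrr addr0.
by apply: filterS2 E0 => x E0 E1 Ox; rewrite E1// E0// subrr addr0.
Qed.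

Lemma norm_semigroupZ t c u : 0 <= t -> Lp u ->
  normLp (S t (fun x => c * u x)) = (`|c|%:E * normLp (S t u))%E.
Proof.
move=> t0 hu; rewrite (eq_normLp_ae p_gt1 _ _ (semigroupZ c t0 hu)).
- by rewrite normLpZ//; exact: (semigroup_Lp hS).
- by apply: (semigroup_Lp hS) => //; exact: LpZ.
- by apply: LpZ => //; exact: (semigroup_Lp hS).
Qed.

Lemma sum_half_powers n : \sum_(k < n) (2^-1 : R) ^+ k.+1 = 1 - 2^-1 ^+ n.
Proof.
elim: n => [|n IH]; first by rewrite big_ord0 expr0 subrr.
by rewrite big_ord_recr/= IH exprS; lra.
Qed.

(** The weights sum to 1, so that Minkowski's inequality bounds the partial
    sums in norm, while the pointwise bound on the [u k] makes the series
    converge everywhere. *)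
Lemma geometric_superposition (u : nat -> V -> R) :
  (forall k, Lp (u k)) -> (forall k, (normLp (u k) <= 1)%E) ->
  (forall k x, 0 <= u k x <= 1) ->
  exists u0, [/\ Lp u0, (normLp u0 <= 1)%E &
    forall k x, 0 <= 2^-1 ^+ k.+1 * u k x <= u0 x].
Proof.
move=> hu nu ub.
pose s n x := \sum_(k < n) 2^-1 ^+ k.+1 * u k x.
have c0 k : 0 <= (2^-1 : R) ^+ k by rewrite exprn_ge0// invr_ge0.
have t0 k x : 0 <= 2^-1 ^+ k.+1 * u k x.
  by rewrite mulr_ge0//; have /andP[] := ub k x.
have snd x : {homo s^~ x : n m / (n <= m)%N >-> n <= m}.
  apply/nondecreasing_seqP => n.
  by rewrite /s big_ord_recr/= lerDl.
have scv x : cvgn (s^~ x).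
  apply: nondecreasing_is_cvgn => //.
  exists 1 => _ [n _ <-]; apply: (@le_trans _ _ (1 - 2^-1 ^+ n)).
    rewrite -sum_half_powers; apply: ler_sum => k _.
    by rewrite ler_piMr//; have /andP[] := ub k x.
  by rewrite lerBlDr lerDl.
pose u0 x := limn (s^~ x).
have su0 n x : s n x <= u0 x by exact: nondecreasing_cvgn_le.
have hs n : Lp (s n) /\ (normLp (s n) <= (1 - 2^-1 ^+ n)%:E)%E.
  elim: n => [|n [IH1 IH2]].
    have -> : s 0%N = fun=> 0 by apply/funext => x; rewrite /s big_ord0.
    rewrite expr0 subrr; split; first exact: Lp0.
    by rewrite normLp0.
  have -> : s n.+1 = fun x => s n x + 2^-1 ^+ n.+1 * u n x.
    by apply/funext => x; rewrite /s big_ord_recr.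
  have hZ : Lp (fun x => 2^-1 ^+ n.+1 * u n x) by exact: LpZ.
  split; first exact: LpD.
  apply: (le_trans (normLpD p_gt1 IH1 hZ)).
  rewrite -sum_half_powers big_ord_recr/= sum_half_powers EFinD leeD//.
  by rewrite normLpZ// ger0_norm// -[leRHS]mule1 lee_wpmul2l// lee_fin.
have [||||hu0 nu0] := @Lp_monotone_limit _ _ Om _ p_gt1 s u0 1 ler01.
- by move=> n; have [] := hs n.
- move=> n; have [_ /le_trans] := hs n; apply.
  by rewrite lee_fin lerBlDr lerDl.
- by move=> n x; rewrite su0 andbT sumr_ge0.
- exact: scv.
exists u0; split => // k x; rewrite t0/=.
apply: le_trans (su0 k.+1 x); rewrite /s big_ord_recr/= lerDr.
by rewrite sumr_ge0.
Qed.

(** Packets that keep half of their norm for a prescribed time are assembled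
    into one orbit decaying more slowly than [g]. The weights [2 ^- (k + 1)] are
    fixed first; they determine the times after which [g] is small enough for
    the k-th packet, and the k-th packet is then required to last until the
    (k+1)-st time. *)
Lemma slow_decay (g : R -> R) :
  (forall T : R, 0 < T -> exists u, [/\ Lp u, forall x, 0 <= u x <= 1,
     normLp u = 1%E & ((2^-1)%:E <= normLp (S T u))%E]) ->
  g t @[t --> +oo] --> 0 ->
  exists (u0 : V -> R) (T : R),
    [/\ Lp u0, forall x, Om x -> 0 <= u0 x, normLp u0 = 1%E, 0 < T &
        forall t, T <= t -> ((g t)%:E <= normLp (S t u0))%E].
Proof.
move=> packets glim.
have half0 k : 0 < (2^-1 : R) ^+ k by rewrite exprn_gt0// invr_gt0.
have times k : exists tau, k.+1%:R <= tau /\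
    forall t, tau <= t -> g t <= 2^-1 * 2^-1 ^+ k.+1.
  have [M [_ hM]] : \forall t \near +oo, g t < 2^-1 * 2^-1 ^+ k.+1.
    by apply: (cvgr_lt _ glim); rewrite mulr_gt0 ?invr_gt0.
  exists (Num.max k.+1%:R (M + 1)); split; first by rewrite le_max lexx.
  move=> t; rewrite ge_max => /andP[_ Mt]; apply: ltW; apply: hM.
  by apply: lt_le_trans Mt; rewrite ltrDl.
have [tau htau] := choice times.
have tau0 k : 0 < tau k by have [h _] := htau k; apply: lt_le_trans h.
have [u hu] := choice (fun k => packets (tau k.+1) (tau0 k.+1)).
have uLp k : Lp (u k) by have [] := hu k.
have [u0 [hu0 nu0 uu0]] : exists u0, [/\ Lp u0, (normLp u0 <= 1)%E &
    forall k x, 0 <= 2^-1 ^+ k.+1 * u k x <= u0 x].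
  apply: geometric_superposition => // k; last by have [] := hu k.
  by have [_ _ -> _] := hu k.
have hZ k : Lp (fun x => 2^-1 ^+ k.+1 * u k x) by exact: LpZ.
have low t : tau 0%N <= t -> ((g t)%:E <= normLp (S t u0))%E.
  move=> t0; have tp : 0 < t by apply: lt_le_trans t0.
  have ex : exists k, t <= tau k.+1.
    exists (Num.truncn t); have [h _] := htau (Num.truncn t).+1.
    apply: le_trans h; apply: ltW; apply: (lt_trans (truncnS_gt t)).
    by rewrite ltr_nat.
  (* By minimality of k, t is also past [tau k]. *)
  have [k tk kmin] := ex_minnP ex.
  have gk : g t <= 2^-1 * 2^-1 ^+ k.+1.
    have [_] := htau k; apply.
    case: k kmin {tk} => // k kmin; rewrite leNgt; apply/negP => /ltW /kmin.
    by rewrite ltnn.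
  apply: (@le_trans _ _ (normLp (S t (fun x => 2^-1 ^+ k.+1 * u k x)))); last first.
    exact: (semigroup_norm_mono p_gt1 hS hk).
  rewrite norm_semigroupZ ?(ltW tp)// gtr0_norm//.
  have [_ _ _ h] := hu k.
  have {}h : ((2^-1)%:E <= normLp (S t (u k)))%E.
    by apply: (le_trans h); apply: (norm_semigroup_le p_gt1 hS) => //; exact: ltW.
  apply: (@le_trans _ _ ((2^-1 ^+ k.+1)%:E * (2^-1)%:E)%E).
    by rewrite -EFinM lee_fin mulrC.
  by apply: lee_wpmul2l => //; rewrite lee_fin ltW.
pose m := fine (normLp u0).
have mE : m%:E = normLp u0 by rewrite /m fineK// normLp_fin.
have m1 : m <= 1 by rewrite -lee_fin mE.
have u0ge x : 0 <= u0 x by have /andP[/le_trans h /h] := uu0 0%N x.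
have m0 : 0 < m.
  rewrite -lte_fin mE.
  apply: (@lt_le_trans _ _ (normLp (fun x => 2^-1 ^+ 1 * u 0%N x))).
    have [_ _ h _] := hu 0%N.
    by rewrite normLpZ// h mule1 lte_fin gtr0_norm.
  apply: le_normLp_ae => //; apply: aeW => x _.
  have /andP[a b] := uu0 0%N x; by rewrite !ger0_norm.
exists (fun x => m^-1 * u0 x), (tau 0%N); split => //.
- exact: LpZ.
- by move=> x _; rewrite mulr_ge0// invr_ge0 ltW.
- by rewrite normLpZ// -mE -EFinM gtr0_norm ?invr_gt0// mulVf// gt_eqF.
- move=> t t0; apply: (le_trans (low t t0)).
  apply: (semigroup_norm_mono p_gt1 hS hk) => //.
  + exact: lt_le_trans t0.
  + exact: LpZ.
  + by move=> x _; rewrite u0ge/= ler_peMl// invf_ge1.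
Qed.

End slow_decay.

(** * A smooth bump on the line *)

Section smooth_bump.
Context (R : realType).
Implicit Types (f g : R -> R) (x c : R).

(** Membership in this class is inherited by sums and products through their
    first derivatives only, which avoids the Leibniz formula of order k. *)
Fixpoint derivable_n k f : Prop :=
  if k is k'.+1 then
    exists2 f', forall x, is_derive x 1 f (f' x) & derivable_n k' f'
  else True.

Lemma derivable_nW k f : derivable_n k.+1 f -> derivable_n k f.
Proof.
by elim: k f => // k IH f [f' ff' hf']; exists f' => //; exact: IH.
Qed.

Lemma derivable_nD k f g : derivable_n k f -> derivable_n k g ->
  derivable_n k (fun x => f x + g x).
Proof.
elim: k f g => // k IH f g [f' df hf] [g' dg hg].
by exists (fun x => f' x + g' x); [move=> x; exact: is_deriveD|exact: IH].
Qed.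

Lemma derivable_nM k f g : derivable_n k f -> derivable_n k g ->
  derivable_n k (fun x => f x * g x).
Proof.
elim: k f g => // k IH f g Hf Hg.
have hf0 := derivable_nW Hf; have hg0 := derivable_nW Hg.
have [f' df hf] := Hf; have [g' dg hg] := Hg.
exists (fun x => f x * g' x + g x * f' x).
  by move=> x; apply: is_deriveM.
by apply: derivable_nD; exact: IH.
Qed.

Lemma derivable_n_cst k c : derivable_n k (fun=> c).
Proof.
elim: k c => // k IH c; exists (fun=> 0) => // x; exact: is_derive_cst.
Qed.

Lemma is_derive_affine f x c (d df : R) : is_derive (d * x + c) 1 f df ->
  is_derive x 1 (fun y => f (d * y + c)) (d * df).
Proof.
move=> hf.
have ha : is_derive x 1 (fun y => d * y + c) d.
  apply: is_derive_eq.
  by rewrite addr0 /GRing.scale/= mulr1.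
by rewrite mulrC; exact: (@is_derive1_comp _ f (fun y => d * y + c)).
Qed.

Lemma derivable_n_affine k f (d c : R) : derivable_n k f ->
  derivable_n k (fun y => f (d * y + c)).
Proof.
elim: k f => // k IH f [f' df hf].
exists (fun y => d * f' (d * y + c)); first by move=> x; exact: is_derive_affine.
by apply: derivable_nM; [exact: derivable_n_cst|exact: IH].
Qed.

(** A smooth function given together with all its derivatives. *)
Definition derivative_tower (F : nat -> R -> R) : Prop :=
  forall k x, is_derive x 1 (F k) (F k.+1 x).

Lemma derivable_n_tower f : (forall k, derivable_n k f) ->
  exists2 F, F 0%N = f & derivative_tower F.
Proof.
move=> hf; exists (fun k => iter k (fun h : R -> R => derive1 h) f) => //.
have H k : forall l, derivable_n l (iter k (fun h : R -> R => derive1 h) f).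
  elim: k => // k IH l; have /= [f' df hl] := IH l.+1.
  rewrite (_ : derive1 _ = f')//; apply/funext => x.
  by rewrite derive1E; exact: derive_val.
move=> k x; have /= [f' df _] := H k 1%N.
by rewrite derive1E; apply: derivableP; exact: (@ex_derive _ _ _ _ _ _ _ (df x)).
Qed.

Lemma tower_continuous F k : derivative_tower F -> continuous (F k).
Proof.
move=> hF x; apply: differentiable_continuous; apply/derivable1_diffP.
exact: (@ex_derive _ _ _ _ _ _ _ (hF k x)).
Qed.

Lemma tower_bounded F k : derivative_tower F ->
  (forall t, t \notin `[0, 1] -> F k t = 0) ->
  exists2 K, 0 <= K & forall t, `|F k t| <= K.
Proof.
move=> F_tower F_supp.
have : bounded_set (F k @` `[0, 1]).
  apply: compact_bounded; apply: continuous_compact; last exact: segment_compact.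
  apply: continuous_subspaceT; exact: tower_continuous.
case=> M [_ hM]; exists (Num.max 0 (M + 1)); first by rewrite le_max lexx.
move=> t; have [ht|ht] := boolP (t \in `[0, 1]); last first.
  by rewrite F_supp// normr0 le_max lexx.
by rewrite le_max; apply/orP; right; apply: hM; [rewrite ltrDl|exists t].
Qed.

Lemma near_is_derive f g x df : (\forall y \near x, f y = g y) ->
  is_derive x 1 g df -> is_derive x 1 f df.
Proof.
move=> fg; apply: near_eq_is_derive; by apply: filterS fg => y ->.
Qed.

(** The functions x^-m exp(-1/x), extended by 0, form a family stable under
    differentiation up to linear combinations ([is_derive_flat_exp]); hence all
    of them are smooth. *)
Definition flat_exp m x : R := if 0 < x then x ^- m * expR (- x^-1) else 0.

(** At 0 the exponential beats every power: exp(1/x) is at least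
    x^-(m+2) / (m+2)!. *)
Lemma flat_exp_le m x : `|flat_exp m x| <= (m.+2)`!%:R * x ^+ 2.
Proof.
rewrite /flat_exp; case: ifPn => x0; last first.
  by rewrite normr0 mulr_ge0// ?sqr_ge0.
rewrite ger0_norm ?mulr_ge0 ?expR_ge0 ?invr_ge0 ?exprn_ge0 ?(ltW x0)//.
rewrite expRN ler_pdivrMr ?expR_gt0//.
have xV0 : 0 <= x^-1 by rewrite invr_ge0 ltW.
apply: (@le_trans _ _ ((m.+2)`!%:R * x ^+ 2 * (x^-1 ^+ m.+2 / (m.+2)`!%:R))).
  rewrite le_eqVlt; apply/orP; left; apply/eqP.
  have f0 : (m.+2)`!%:R != 0 :> R by rewrite pnatr_eq0 -lt0n fact_gt0.
  have x0' : x != 0 by rewrite gt_eqF.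
  move: f0; move: ((m.+2)`!%:R) => F f0.
  rewrite -exprVn -[m.+2]addn2 exprD; move: (x^-1 ^+ m) => w; field.
  by rewrite f0 x0'.
apply: ler_wpM2l; first by rewrite mulr_ge0// sqr_ge0.
by apply: le_trans (expR_ge1Dxn m.+1 xV0); rewrite lerDr.
Qed.

(** The difference quotient at 0 is bounded by [c * `|h|]. *)
Lemma is_derive0_quadratic f c : (forall x, `|f x| <= c * x ^+ 2) ->
  is_derive (0 : R) (1 : R) f 0.
Proof.
move=> hf; have f0 : f 0 = 0.
  by apply/eqP; rewrite -normr_le0 (le_trans (hf 0))// expr0n/= mulr0.
have lim : h^-1 *: ((f \o shift 0) (h *: (1 : R)) - f 0) @[h --> 0^'] --> (0 : R).
  apply/cvgr0Pnorm_le => e e0.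
  have c0 : 0 <= c by have := hf 1; rewrite expr1n mulr1; apply: le_trans.
  have d0 : 0 < e / (c + 1) by rewrite divr_gt0// ltr_wpDl.
  exists (e / (c + 1)) => //= h /=; rewrite sub0r normrN => he hn0.
  rewrite addr0 f0 subr0 scaler1 normrM normfV.
  rewrite ler_pdivrMl ?normr_gt0//.
  apply: (le_trans (hf h)).
  rewrite -real_normK ?num_real// expr2 mulrCA ler_wpM2l//.
  move: he; rewrite ltr_pdivlMr ?ltr_wpDl// => /ltW; apply: le_trans.
  by rewrite mulrDr mulr1 mulrC lerDl.
split; first by apply/cvg_ex; exists 0.
exact: (cvg_lim _ lim).
Qed.

Lemma is_derive_flat_exp m x :
  is_derive x 1 (flat_exp m) (flat_exp m.+2 x - m%:R * flat_exp m.+1 x).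
Proof.
have [x0|x0|<-] := ltgtP 0 x.
- have x0' : x != 0 by rewrite gt_eqF.
  pose V := fun y : R => y^-1.
  have dV : is_derive x 1 V (- x ^- 2).
    apply: is_derive_eq (@is_deriveV R id x 1 1 x0' _) _.
    by rewrite /GRing.scale/= mulr1.
  have dE := @is_derive1_comp R expR (- V) x _ _ (is_derive_expR _) (is_deriveN dV).
  have dX : is_derive x 1 (V ^+ m) (- m%:R * x^-1 ^+ m.+1).
    apply: is_derive_eq (is_deriveX m dV) _; rewrite /GRing.scale/= /V.
    by case: m => [|m]; rewrite ?mul0r ?oppr0 ?mul0r//= -exprVn !exprS; ring.
  apply: (@near_is_derive _ (V ^+ m * (expR \o - V))).
    near=> y; rewrite /flat_exp ifT; first by rewrite !fctE -exprVn /V.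
    by near: y; exact: lt_nbhsr.
  apply: is_derive_eq (is_deriveM dX dE) _.
  rewrite !fctE/= /flat_exp x0 /V /GRing.scale/= -!exprVn !exprS; ring.
- apply: (@near_is_derive _ (fun=> 0)); last first.
    rewrite /flat_exp ltNge (ltW x0)/= mulr0 subr0; exact: is_derive_cst.
  near=> y; rewrite /flat_exp ifF//; apply/negbTE; rewrite -leNgt; apply: ltW.
  near: y; exact: lt_nbhsl.
- rewrite /flat_exp ltxx mulr0 subr0.
  apply: (@is_derive0_quadratic _ (m.+2)`!%:R); exact: flat_exp_le.
Unshelve. all: by end_near.
Qed.

Lemma derivable_n_flat_exp k m : derivable_n k (flat_exp m).
Proof.
elim: k m => // k IH m.
exists (fun x => flat_exp m.+2 x - m%:R * flat_exp m.+1 x).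
  by move=> x; exact: is_derive_flat_exp.
apply: derivable_nD; first exact: IH.
under [X in derivable_n _ X]eq_fun do rewrite -mulNr.
by apply: derivable_nM; [exact: derivable_n_cst|exact: IH].
Qed.

Lemma flat_exp_ge0 x : 0 <= flat_exp 0 x.
Proof. by rewrite /flat_exp; case: ifP => // _; rewrite expr0 invr1 mul1r expR_ge0. Qed.

Lemma flat_exp_le1 x : flat_exp 0 x <= 1.
Proof.
rewrite /flat_exp; case: ifP => // x0; rewrite expr0 invr1 mul1r expR_le1.
by rewrite oppr_le0 invr_ge0 ltW.
Qed.

Lemma flat_exp_lower x : 4^-1 <= x -> expR (-4) <= flat_exp 0 x.
Proof.
move=> hx; have x0 : 0 < x by apply: lt_le_trans hx; rewrite invr_gt0.
rewrite /flat_exp x0 expr0 invr1 mul1r ler_expR lerN2.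
by rewrite -[leRHS]invrK lef_pV2 ?posrE ?invr_gt0.
Qed.

(** The product of exp(-1/x) and of its mirror image exp(-1/(1-x)). *)
Lemma smooth_bump : exists F : nat -> R -> R,
  [/\ derivative_tower F, forall x, 0 <= F 0%N x <= 1,
      exists2 c, 0 < c & forall x, 4^-1 <= x <= 3 / 4 -> c <= F 0%N x &
      forall k x, x \notin `[0, 1] -> F k x = 0].
Proof.
pose b x := flat_exp 0 x * flat_exp 0 (-1 * x + 1).
have hb k : derivable_n k b.
  apply: derivable_nM; first exact: derivable_n_flat_exp.
  apply: derivable_n_affine; exact: derivable_n_flat_exp.
have [F F0 hF] := derivable_n_tower hb.
exists F; split => //.
- by move=> x; rewrite F0 /b mulr_ge0 ?flat_exp_ge0//= mulr_ile1 ?flat_exp_ge0 ?flat_exp_le1.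
- exists (expR (-4) * expR (-4)); first by rewrite mulr_gt0 ?expR_gt0.
  move=> x /andP[x1 x2]; rewrite F0 /b ler_pM ?expR_ge0 ?flat_exp_lower//.
  by rewrite mulN1r addrC; lra.
- elim=> [|k IH] x hx.
    rewrite F0 /b /flat_exp; move: hx; rewrite in_itv/= negb_and -!ltNge => /orP[h|h].
      by rewrite ifF ?mul0r//; apply/negbTE; rewrite -leNgt ltW.
    rewrite [X in _ * X]ifF ?mulr0//; apply/negbTE; rewrite -leNgt.
    by rewrite mulN1r addrC subr_le0 ltW.
  have : \forall y \near x, y \notin `[(0 : R), 1].
    move: hx; rewrite in_itv/= negb_and -!ltNge => /orP[h|h].
      near=> y; rewrite in_itv/= negb_and -!ltNge; apply/orP; left.
      near: y; exact: lt_nbhsl.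
    near=> y; rewrite in_itv/= negb_and -!ltNge; apply/orP; right.
    near: y; exact: lt_nbhsr.
  move=> hn.
  have h0 : is_derive x 1 (F k) 0.
    apply: (@near_is_derive _ (fun=> 0)).
    by apply: filterS hn => y /IH.
  by rewrite -(@derive_val _ _ _ _ _ _ _ (hF k x)) (@derive_val _ _ _ _ _ _ _ h0).
Unshelve. all: by end_near.
Qed.

End smooth_bump.

(** * Borel sets, boxes and line integrals in R^n *)

Section borel_rV.
Context (R : realType) (n : nat).
Local Notation V := 'rV[R]_n.

Lemma measurable_cylinder (P : 'I_n -> set R) :
  (forall i, measurable (P i : set (measurableTypeR R))) ->
  measurable [set x : V | forall i, P i (x ord0 i)].
Proof.
move=> mP; rewrite (_ : [set _ | _] = \bigcap_i [set x : V | P i (x ord0 i)]).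
  apply: fin_bigcap_measurable => // i _.
  rewrite -[X in measurable X]setTI.
  exact: measurable_rV_coord (mP i).
by apply/seteqP; split => [x h i _|x h i]; [exact: h|exact: h].
Qed.

Lemma rV_ballE (x y : V) (r : R) : 0 < r ->
  ball x r y <-> forall i, `|x ord0 i - y ord0 i| < r.
Proof.
move=> r0; split => [[_ h] i|h]; first exact: (h ord0 i).
by split=> // i j; rewrite [i]ord1; exact: h.
Qed.

(** An open set is the union of the balls with rational centre and radius
    1/(k+1) that it contains; balls of the sup norm are cylinders. *)
Lemma open_measurable_rV (U : set V) : open U -> measurable U.
Proof.
move=> oU.
pose q (z : 'rV[rat]_n) : V := map_mx ratr z.
pose F (z : 'rV[rat]_n * nat) : set V :=
  [set y | ball (q z.1) z.2.+1%:R^-1 `<=` U /\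
     forall i, `|q z.1 ord0 i - y ord0 i| < z.2.+1%:R^-1].
rewrite (_ : U = \bigcup_z F z).
  apply: countable_bigcupT_measurable => // z.
  have [h|h] := pselect (ball (q z.1) z.2.+1%:R^-1 `<=` U); last first.
    by rewrite (_ : F z = set0)//; apply/seteqP; split => // y [].
  rewrite (_ : F z = [set y | forall i, `|q z.1 ord0 i - y ord0 i| < z.2.+1%:R^-1]).
    apply: (measurable_cylinder (P := fun i =>
      [set t | `|q z.1 ord0 i - t| < z.2.+1%:R^-1])).
    move=> i; apply: open_measurable.
    exact: (@ball_open _ R^o).
  by apply/seteqP; split => y; [case|split].
apply/seteqP; split => [x Ux|y [z _ [h hy]]]; last first.
  by apply: h; apply/rV_ballE; rewrite ?invr_gt0.
have /nbhs_ballP[e /= e0 he] : nbhs x U by exact: open_nbhs_nbhs.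
pose k := Num.truncn (2 / e).
have ke : k.+1%:R^-1 < e / 2.
  rewrite -[ltRHS]invrK ltf_pV2 ?posrE ?invr_gt0 ?divr_gt0// invf_div.
  exact: truncnS_gt.
have k0 : 0 < k.+1%:R^-1 :> R by rewrite invr_gt0.
have /choice[z hz] : forall i : 'I_n, exists z : rat,
    ratr z \in `]x ord0 i - k.+1%:R^-1, x ord0 i + k.+1%:R^-1[.
  by move=> i; apply: rat_in_itvoo; rewrite ltrBlDr -addrA ltrDl addr_gt0.
exists (\row_i z i, k) => //=; split => /=; last first.
  move=> i; rewrite !mxE; have := hz i; rewrite in_itv/= => /andP[h1 h2].
  rewrite ltr_norml; move: (k.+1%:R^-1) h1 h2 => d; lra.
move=> y /rV_ballE => /(_ k0) hy; apply: he; apply/rV_ballE => // i.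
have := hy i; rewrite !mxE; have := hz i; rewrite in_itv/= => /andP[h1 h2].
rewrite !ltr_norml => /andP[h3 h4].
move: (k.+1%:R^-1) h1 h2 h3 h4 ke => d; lra.
Qed.

Lemma continuous_measurable_rV (f : V -> R) : continuous f ->
  measurable_fun [set: V] (f : V -> measurableTypeR R).
Proof.
move=> /continuousP cf; apply: (measurability _ (RGenOpens.measurableE R)).
move=> _ [_ [a [b ->] <-]]; rewrite setTI; apply: open_measurable_rV.
exact/cf/interval_open.
Qed.

End borel_rV.

Section boxes.
Context (R : realType).
Local Notation leb := (lebesgue_rV R).

Definition box n (a b : R) : set 'rV[R]_n := [set x | forall i, x ord0 i \in `[a, b]].

Lemma measurable_box n a b : measurable (@box n a b).
Proof.
exact: (measurable_cylinder (P := fun=> [set t | t \in `[a, b]])).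
Qed.

Lemma rV_cons0 n (t : R) (x : 'rV[R]_n) : rV_cons t x ord0 (lshift n (@ord0 0)) = t.
Proof. by apply: (etrans (row_mxEl (const_mx t) x _ _)); rewrite mxE. Qed.

Lemma rV_consS n (t : R) (x : 'rV[R]_n) i : rV_cons t x ord0 (rshift 1 i) = x ord0 i.
Proof. exact: (row_mxEr (const_mx t) x). Qed.

Lemma box_cons n a b (t : R) (x : 'rV[R]_n) :
  box a b (rV_cons t x) <-> t \in `[a, b] /\ box a b x.
Proof.
split => [h|[ht hx] i].
  split; first by have := h (lshift n (@ord0 0)); rewrite rV_cons0.
  by move=> i; have := h (rshift 1 i); rewrite rV_consS.
have [j ->|j ->] := @fintype.split_ordP 1 n i.
  by rewrite [j]ord1 rV_cons0.
by rewrite rV_consS.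
Qed.

Lemma volume_box n a b : a <= b -> leb n (@box n a b) = ((b - a) ^+ n)%:E.
Proof.
move=> ab; elim: n => [|n IH].
  rewrite expr0 /= diracE mem_set//; first by case.
rewrite /= /pushforward.
rewrite (_ : _ @^-1` _ = box a b `*` [set` `[a, b]]); last first.
  apply/seteqP; split => [[x t] /box_cons[]//|[x t] [h1 h2]]; exact/box_cons.
rewrite product_measure1E//; last exact: measurable_box.
rewrite IH.
transitivity (((b - a) ^+ n)%:E * (b - a)%:E)%E; last by rewrite -EFinM exprSr.
congr (_ * _)%E; apply: (etrans (lebesgue_measure_itv `[a, b])); rewrite /= lte_fin.
by move: ab; rewrite le_eqVlt => /predU1P[->|-> //]; rewrite ltxx subrr.
Qed.

Lemma sigma_finite_rV n : sigma_finite [set: 'rV[R]_n] (leb n).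
Proof.
exists (fun k => @box n (- k%:R) k%:R).
  apply/seteqP; split => // x _.
  pose M := \sum_i `|x ord0 i|.
  exists (Num.truncn M).+1 => //= i; rewrite in_itv/= -ler_norml.
  apply: ltW; apply: le_lt_trans (truncnS_gt M).
  by rewrite /M (bigD1 i)//= lerDl sumr_ge0.
move=> k; split; first exact: measurable_box.
by rewrite volume_box ?ltry// -subr_ge0 opprK addr_ge0.
Qed.

(** An alias of the Lebesgue measure, to which the proof of sigma-finiteness
    required by Fubini's theorem can be attached. *)
Definition lebesgue_rV_fun n : set 'rV[R]_n -> \bar R := leb n.
HB.instance Definition _ n := Measure.on (@lebesgue_rV_fun n).
HB.instance Definition _ n := @Measure_isSigmaFinite.Build _ _ R
  (@lebesgue_rV_fun n) (@sigma_finite_rV n).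

End boxes.

Section integral_lines.
Context (R : realType).
Local Notation leb := (lebesgue_rV R).

(** Bounded measurable functions vanishing off the cube [[a, b]^n]: a class of
    integrable functions which is stable under freezing a coordinate, unlike
    integrability itself. *)
Definition boxed n (a b M : R) (h : 'rV[R]_n -> R) : Prop :=
  [/\ measurable_fun [set: 'rV[R]_n] (h : 'rV[R]_n -> measurableTypeR R),
      forall x, `|h x| <= M & forall x, ~ box a b x -> h x = 0].

Lemma boxed_integral_le n a b M (h : 'rV[R]_n -> R) : a <= b -> boxed a b M h ->
  (\int[leb n]_x `|(h x)%:E| <= (M * (b - a) ^+ n)%:E)%E.
Proof.
move=> ab [mh hM h0]; have mbox := @measurable_box R n a b.
have M0 : 0 <= M by apply: le_trans (hM 0).
apply: (@le_trans _ _ (\int[leb n]_(x in box a b) (cst M%:E) x)%E).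
  rewrite [leRHS]integral_mkcond; apply: ge0_le_integral => //.
  - by apply: measurableT_comp => //; exact/measurable_EFinP.
  - by apply/(measurable_restrictT _ mbox); exact: measurable_cst.
  - move=> x _; rewrite /patch; case: ifPn => [_|/negP hx]; first by rewrite lee_fin.
    by rewrite h0; [rewrite abse0|move=> /mem_set].
by rewrite integral_cst// volume_box// EFinM.
Qed.

Lemma boxed_integrable n a b M (h : 'rV[R]_n -> R) : a <= b -> boxed a b M h ->
  (leb n).-integrable [set: 'rV[R]_n] (EFin \o h).
Proof.
move=> ab bh; have [mh _ _] := bh; apply/integrableP; split.
  exact/measurable_EFinP.
exact: le_lt_trans (boxed_integral_le ab bh) (ltry _).
Qed.

Lemma rV_cons_shift0 n (t : R) (x : 'rV[R]_n) :
  rV_cons 0 x + t *: delta_mx ord0 (lshift n (@ord0 0)) = rV_cons t x.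
Proof.
apply/rowP => i; rewrite [LHS]mxE [X in _ + X]mxE [X in _ * X]mxE eqxx.
have [j ->|j ->] := @fintype.split_ordP 1 n i.
  by rewrite [j]ord1 !rV_cons0 eqxx add0r mulr1.
by rewrite !rV_consS eq_rlshift mulr0 addr0.
Qed.

Lemma rV_cons_shiftS n (s t : R) (x : 'rV[R]_n) j :
  rV_cons s x + t *: delta_mx ord0 (rshift 1 j) =
  rV_cons s (x + t *: delta_mx ord0 j).
Proof.
apply/rowP => i; rewrite [LHS]mxE [X in _ + X]mxE [X in _ * X]mxE eqxx.
have [k ->|k ->] := @fintype.split_ordP 1 n i.
  by rewrite [k]ord1 !rV_cons0 eq_lrshift mulr0 addr0.
by rewrite !rV_consS !mxE eqxx eq_rshift.
Qed.

(** The change of variables through which the measure on R^(n+1) is defined. *)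
Lemma integral_rV_cons n a b M (h : 'rV[R]_n.+1 -> R) : a <= b -> boxed a b M h ->
  (leb n \x lebesgue_measure)%E.-integrable setT
    (fun z : 'rV[R]_n * measurableTypeR R => (h (rV_cons z.2 z.1))%:E) /\
  (\int[leb n.+1]_x (h x)%:E =
   \int[leb n \x lebesgue_measure]_z (h (rV_cons z.2 z.1))%:E)%E.
Proof.
move=> ab bh; have [mh _ _] := bh.
have mc := @measurable_rV_cons R n.
have mhE : measurable_fun setT (fun x : 'rV[R]_n.+1 => (h x)%:E).
  exact/measurable_EFinP.
have I1 : (leb n \x lebesgue_measure)%E.-integrable setT
    (fun z : 'rV[R]_n * measurableTypeR R => (h (rV_cons z.2 z.1))%:E).
  apply/integrableP; split.
    exact: (measurableT_comp mhE mc).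
  have := ge0_integral_pushforward mc (leb n \x lebesgue_measure)%E measurableT
    (measurableT_comp (@abse_measurable R setT) mhE) _.
  rewrite preimage_setT => <-; last by move=> y _; exact: abse_ge0.
  exact: le_lt_trans (boxed_integral_le ab bh) (ltry _).
split => //.
have := integral_pushforward mc mhE _ measurableT.
by rewrite preimage_setT; apply.
Qed.

Lemma boxed_rV_cons n a b M (h : 'rV[R]_n.+1 -> R) (t : R) :
  boxed a b M h -> boxed a b M (fun x => h (rV_cons t x)).
Proof.
move=> [mh hM h0]; split => //.
  apply: (measurableT_comp mh).
  apply: (measurableT_comp (@measurable_rV_cons R n) (g := fun x => (x, t))).
  exact: measurable_pair2.
by move=> x hx; apply: h0 => /box_cons[].
Qed.

(** Fubini's theorem along an arbitrary axis. The measure singles out the first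
    coordinate: the induction peels off coordinates until the axis [i] comes
    first. *)
Lemma integral_lines0 n a b M (h : 'rV[R]_n -> R) i : a <= b -> boxed a b M h ->
  (forall x, (\int[lebesgue_measure]_t (h (x + t *: delta_mx ord0 i))%:E = 0)%E) ->
  (\int[leb n]_x (h x)%:E = 0)%E.
Proof.
move=> ab; elim: n h i => [|n IH] h i bh hl; first by case: i hl.
have [int ->] := integral_rV_cons ab bh.
have [j ij|j ij] := @fintype.split_ordP 1 n i.
  rewrite -(@integral12_prod_meas1 _ _ _ _ R (@lebesgue_rV_fun R n) lebesgue_measure)//.
  apply: integral0_eq => x _; rewrite /fubini_F /=.
  rewrite -[RHS](hl (rV_cons 0 x)); apply: eq_integral => t _.
  by rewrite ij [j]ord1 rV_cons_shift0.
rewrite -(@integral21_prod_meas1 _ _ _ _ R (@lebesgue_rV_fun R n) lebesgue_measure)//.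
apply: integral0_eq => t _; rewrite /fubini_G /=.
apply: (IH (fun x => h (rV_cons t x)) j); first exact: boxed_rV_cons.
move=> x; rewrite -[RHS](hl (rV_cons t x)); apply: eq_integral => s _.
by rewrite ij rV_cons_shiftS.
Qed.

End integral_lines.

(** * Integration by parts and functions supported in a box *)

Section integration_by_parts.
Context (R : realType) (N : nat).
Local Notation V := 'rV[R]_N.
Local Notation leb := (lebesgue_rV R N).

Lemma is_derive_line (F : V -> R) (x v : V) (t : R) : derivable F (x + t *: v) v ->
  is_derive t 1 (fun s : R => F (x + s *: v)) ('D_v F (x + t *: v)).
Proof.
move=> dF.
have E : (fun h : R => h^-1 *: (((fun s : R => F (x + s *: v)) \o shift t)
    (h *: (1 : R)) - F (x + t *: v))) =
  (fun h : R => h^-1 *: ((F \o shift (x + t *: v)) (h *: v) - F (x + t *: v))).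
  apply/funext => h; rewrite /= /shift /=.
  by rewrite (_ : h%:A = h) ?scalerDl 1?addrCA//; exact: mulr1.
by split; [rewrite /derivable E|rewrite /derive E].
Qed.

Lemma compact_box a b : compact (@box R N a b).
Proof.
have := @rV_compact R N (fun=> [set` `[a, b]]); apply => i; exact: segment_compact.
Qed.

Lemma boxed_of_continuous a b (h : V -> R) : continuous h ->
  (forall x, ~ box a b x -> h x = 0) -> exists M, boxed a b M h.
Proof.
move=> ch h0.
have : bounded_set (h @` box a b).
  apply: compact_bounded; apply: continuous_compact; last exact: compact_box.
  exact: continuous_subspaceT.
case=> M [_ hM]; exists (Num.max 0 (M + 1)); split => //.
  exact: continuous_measurable_rV.
move=> x; have [bx|bx] := pselect (box a b x); last by rewrite h0// normr0 le_max lexx.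
by rewrite le_max; apply/orP; right; apply: hM; [rewrite ltrDl|exists x].
Qed.

(** On each line parallel to the axis [i], the integral of the derivative of a
    function with bounded support vanishes by the fundamental theorem of
    calculus. *)
Lemma integral_partial0 i a b (F h : V -> R) : a <= b ->
  (forall x, derivable F x (delta_mx ord0 i)) -> (forall x, partial i F x = h x) ->
  continuous h ->
  (forall x, ~ box a b x -> F x = 0) -> (forall x, ~ box a b x -> h x = 0) ->
  (\int[leb]_x (h x)%:E = 0)%E.
Proof.
move=> ab dF Fh ch F0 h0.
have [M bM] := boxed_of_continuous ch h0.
apply: (integral_lines0 (i := i) ab bM) => x.
pose v : V := delta_mx ord0 i.
(* The margin 1 leaves room for the endpoints to be off the support. *)
pose A := a - x ord0 i - 1; pose B := b - x ord0 i + 1.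
have AB : A < B by rewrite /A /B; lra.
have off t : t \notin `]A, B[ -> ~ box a b (x + t *: v).
  move=> + /(_ i); rewrite !in_itv/= !mxE !eqxx mulr1 => + /andP[h1 h2].
  by move=> /negP; apply; rewrite /A /B; apply/andP; split; lra.
have dl t := is_derive_line (dF (x + t *: v)).
have contl (f : V -> R) : continuous f -> continuous (fun t : R => f (x + t *: v)).
  move=> cf t; apply: (@continuous_comp _ _ _ (fun t : R => x + t *: v) f); last exact: cf.
  by apply: cvgD; [exact: cvg_cst|exact: cvgZr_tmp].
have -> : (\int[lebesgue_measure]_t (h (x + t *: v))%:E =
    \int[lebesgue_measure]_(t in `[A, B]) (h (x + t *: v))%:E)%E.
  rewrite [RHS]integral_mkcond; apply: eq_integral => t _.
  rewrite /patch; case: ifPn => // /negP tAB; rewrite h0//; apply: off.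
  apply/negP => tAB'; apply: tAB; rewrite inE /=.
  exact: subset_itv_oo_cc tAB'.
have dvl (t : R) : derivable (fun s : R => F (x + s *: v)) t (1 : R).
  exact: (@ex_derive _ _ _ _ _ _ _ (dl t)).
have cF : continuous (fun s : R => F (x + s *: v)).
  move=> t; apply: differentiable_continuous; exact/derivable1_diffP.
rewrite (@continuous_FTC2 _ _ (fun s : R => F (x + s *: v)))//.
- rewrite (F0 (x + B *: v)) ?(F0 (x + A *: v)) ?subee//; apply: off.
  + by rewrite in_itv/= ltxx.
  + by rewrite in_itv/= ltxx andbF.
- by apply: continuous_subspaceT; exact: contl.
- split; first by move=> t _; exact: dvl.
  + by apply: cvg_at_right_filter; exact: cF.
  + by apply: cvg_at_left_filter; exact: cF.
- move=> t _; rewrite derive1E (@derive_val _ _ _ _ _ _ _ (dl t)).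
  exact: Fh.
Qed.

(** [integral_partial0] applied to the product [u * phi], which vanishes off the
    cube because [u] does. *)
Lemma integral_by_parts i a b (u v phi : V -> R) : a <= b ->
  continuous u -> continuous v -> continuous phi -> continuous (partial i phi) ->
  (forall x, derivable u x (delta_mx ord0 i)) -> (forall x, partial i u x = v x) ->
  (forall x, derivable phi x (delta_mx ord0 i)) ->
  (forall x, ~ box a b x -> u x = 0) -> (forall x, ~ box a b x -> v x = 0) ->
  \int[leb]_x (u x * partial i phi x) = - \int[leb]_x (v x * phi x).
Proof.
move=> ab cu cv cphi cdphi du uv dphi u0 v0.
have c1 : continuous (fun x => u x * partial i phi x).
  by move=> x; apply: continuousM; [exact: cu|exact: cdphi].
have c2 : continuous (fun x => v x * phi x).
  by move=> x; apply: continuousM; [exact: cv|exact: cphi].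
have c3 : continuous (fun x : V => u x * partial i phi x + v x * phi x).
  by move=> x; exact: (continuousD (c1 x) (c2 x)).
have z1 x : ~ box a b x -> u x * partial i phi x = 0 by move=> /u0 ->; rewrite mul0r.
have z2 x : ~ box a b x -> v x * phi x = 0 by move=> /v0 ->; rewrite mul0r.
have [M1 b1] := boxed_of_continuous c1 z1.
have [M2 b2] := boxed_of_continuous c2 z2.
have i1 := boxed_integrable ab b1; have i2 := boxed_integrable ab b2.
apply/eqP; rewrite -subr_eq0 opprK -RintegralD//; apply/eqP.
rewrite /Rintegral (@integral_partial0 i a b (u * phi))//.
- by move=> x; exact: derivableM.
- move=> x; rewrite /partial deriveM//; congr (_ + _).
  by rewrite -/(partial i u x) uv /GRing.scale/= mulrC.
- by move=> x /u0 h; transitivity (u x * phi x); rewrite // h mul0r.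
- by move=> x hx; rewrite z1// z2// addr0.
Qed.

End integration_by_parts.

Section supported_functions.
Context (R : realType) (N : nat) (Om : set 'rV[R]_N) (p : R) (p_gt1 : 1 < p).
Context (a b : R) (ab : a <= b) (bOm : box a b `<=` Om).
Local Notation V := 'rV[R]_N.
Local Notation leb := (lebesgue_rV R N).
Let p0 : 0 < p. Proof. exact: lt_trans p_gt1. Qed.

Lemma restrict_supported (u : V -> R) : (forall x, ~ box a b x -> u x = 0) ->
  u \_ Om = u.
Proof.
move=> u0; apply/funext => x; rewrite /patch; case: ifPn => // /negP xOm.
by rewrite u0// => /bOm /mem_set.
Qed.

Lemma normLp_powR (u : V -> R) : (forall x, ~ box a b x -> u x = 0) ->
  (normLp Om p u = (\int[leb]_x (`|u x| `^ p)%:E) `^ p^-1)%E.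
Proof.
by move=> u0; rewrite /normLp restrict_supported// unlock; congr (_ `^ _)%E.
Qed.

Lemma Lp_boxed M (u : V -> R) : boxed a b M u ->
  Lp Om p u /\ (normLp Om p u <= (M `^ p * (b - a) ^+ N)%:E `^ p^-1)%E.
Proof.
move=> bu; have [mu uM u0] := bu.
have M0 : 0 <= M by apply: le_trans (uM 0).
have bp : boxed a b (M `^ p) (fun x => `|u x| `^ p).
  split.
  - apply: (measurableT_comp (measurable_powR p)); exact: measurableT_comp.
  - move=> x; rewrite ger0_norm ?powR_ge0// ge0_ler_powR// ?nnegrE//; exact: ltW.
  - by move=> x /u0 ->; rewrite normr0 powR0// gt_eqF.
have le : (normLp Om p u <= (M `^ p * (b - a) ^+ N)%:E `^ p^-1)%E.
  rewrite normLp_powR//; apply: gt0_ler_poweR.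
  - by rewrite invr_ge0 ltW.
  - by rewrite in_itv/= leey andbT integral_ge0.
  - by rewrite in_itv/= leey andbT lee_fin mulr_ge0 ?powR_ge0// exprn_ge0// subr_ge0.
  apply: le_trans (boxed_integral_le ab bp).
  apply: ge0_le_integral => //.
  + by apply/measurable_EFinP; have [] := bp.
  + by apply: measurableT_comp => //; apply/measurable_EFinP; have [] := bp.
  + by move=> x _; rewrite lee_fin ler_norm.
split => //; apply/andP; split; rewrite inE/=.
  by rewrite restrict_supported.
by rewrite /finite_norm; apply: (le_lt_trans le); rewrite poweR_EFin ltry.
Qed.

Lemma normLp_ge_box M (u : V -> R) (a' b' c : R) : boxed a b M u ->
  a' <= b' -> 0 <= c -> (forall x, box a' b' x -> c <= u x) ->
  ((c `^ p * (b' - a') ^+ N)%:E `^ p^-1 <= normLp Om p u)%E.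
Proof.
move=> [mu uM u0] ab' c0 cu; rewrite normLp_powR//; apply: gt0_ler_poweR.
- by rewrite invr_ge0 ltW.
- by rewrite in_itv/= leey andbT lee_fin mulr_ge0 ?powR_ge0// exprn_ge0// subr_ge0.
- by rewrite in_itv/= leey andbT integral_ge0.
have mb := @measurable_box R N a' b'.
have mf : measurable_fun setT (fun x => (`|u x| `^ p)%:E).
  apply/measurable_EFinP.
  apply: (measurableT_comp (measurable_powR p)); exact: measurableT_comp.
apply: (@le_trans _ _ (\int[leb]_(x in box a' b') (`|u x| `^ p)%:E)%E); last first.
  apply: ge0_subset_integral => // x _; by rewrite lee_fin powR_ge0.
rewrite EFinM -(volume_box N ab') -integral_cst//; apply: ge0_le_integral => //.
- by move=> x _; rewrite lee_fin powR_ge0.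
- exact: measurable_funTS.
- move=> x hx; rewrite lee_fin ge0_ler_powR ?nnegrE//; first exact: ltW.
  exact: le_trans (cu x hx) (ler_norm _).
Qed.

(** For functions vanishing off a cube inside [Om], classical derivatives are
    weak ones, since the integrals over [Om] extend to the whole space. *)
Lemma weak_partial_supported i (u v : V -> R) :
  continuous u -> continuous v ->
  (forall x, derivable u x (delta_mx ord0 i)) -> (forall x, partial i u x = v x) ->
  (forall x, ~ box a b x -> u x = 0) -> (forall x, ~ box a b x -> v x = 0) ->
  weak_partial Om p i u v.
Proof.
move=> cu cv du uv u0 v0.
have [Mu bu] := boxed_of_continuous cu u0.
have [Mv bv] := boxed_of_continuous cv v0.
split; [by case: (Lp_boxed bu)|by case: (Lp_boxed bv)|].
move=> phi [sphi _ _]; have [cphi dphi cdphi] := sphi 1%N.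
have mk (w g : V -> R) : (forall x, ~ box a b x -> w x = 0) ->
    \int[leb]_(x in Om) (w x * g x) = \int[leb]_x (w x * g x).
  move=> w0; rewrite /Rintegral integral_mkcond; congr fine.
  apply: eq_integral => x _; rewrite /patch; case: ifPn => // /negP xOm.
  by rewrite w0 ?mul0r// => /bOm /mem_set.
rewrite !mk//; exact: (integral_by_parts ab).
Qed.

End supported_functions.

(** * Product bumps belong to the domain of the Laplacian *)

Lemma holder_class_Ck (R : realType) n k alpha (f : 'rV[R]_n -> R) :
  holder_class k.+1 alpha f -> Ck k f.
Proof.
by elim: k f => [|k IH] f [cf df hf] //; split => // i; exact: IH.
Qed.

(** The normal is the gradient of a local graph of the boundary, which is of class
    C^1. *)
Lemma outward_normal_exists (R : realType) N alpha (Om : set 'rV[R]_N) :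
  holder_domain 2 alpha Om ->
  exists n : 'rV[R]_N -> 'rV[R]_N,
    forall x, boundary Om x -> outward_unit_normal Om x (n x).
Proof.
move=> hd; suff /choice[n hn] : forall x, exists nu,
    boundary Om x -> outward_unit_normal Om x nu.
  by exists n.
move=> x; have [bx|bx] := pselect (boundary Om x); last by exists 0.
have [s [i [b [gamma [hg lg]]]]] := hd x bx.
eexists => _; exists s, i, b, gamma.
split; [exact: holder_class_Ck hg|exact: lg|reflexivity].
Qed.

Section product_bumps.
Context (R : realType) (N : nat) (F : nat -> R -> R) (a r : R).
Context (F_tower : derivative_tower F)
  (F_supp : forall k t, t \notin `[0, 1] -> F k t = 0).
Context (r0 : 0 < r).
Local Notation V := 'rV[R]_N.
Implicit Types (m : 'I_N -> nat) (x : V).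

(** The k-th derivative of [F 0] transported from [[0, 1]] to [[a, a + r]]; the
    factor [r ^- k] makes the family a tower again ([rescale_tower]). *)
Definition rescale k (t : R) : R := r^-1 ^+ k * F k (r^-1 * t + - (a / r)).

Lemma rescale_tower : derivative_tower rescale.
Proof.
move=> k t; rewrite /rescale.
have h := is_derive_affine (F_tower k (r^-1 * t + - (a / r))).
apply: is_derive_eq (is_deriveZ _ h) _.
by rewrite /GRing.scale/= mulrA -exprSr.
Qed.

Lemma rescale_supp k t : t \notin `[a, a + r] -> rescale k t = 0.
Proof.
move=> ht; rewrite /rescale F_supp ?mulr0//; apply: contra ht.
rewrite !in_itv/= => /andP[h1 h2].
have E : r^-1 * t + - (a / r) = (t - a) / r by field; rewrite gt_eqF.
move: h1 h2; rewrite E ler_pdivrMr// pmulr_lge0 ?invr_gt0// mul1r; lra.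
Qed.

(** The partial derivative of order m of the product bump, m being a
    multi-index: differentiating along [j] increments the index [j]
    ([bump_partial]), so that all derivatives are treated at once. *)
Definition bump m x : R := \prod_i rescale (m i) (x ord0 i).

Definition incr_at m j : 'I_N -> nat := fun i => if i == j then (m i).+1 else m i.

Lemma bump_supp m x : ~ box a (a + r) x -> bump m x = 0.
Proof.
move=> hx; have [i hi] : exists i, x ord0 i \notin `[a, a + r].
  by apply: contrapT => hn; apply: hx => i; apply/negP => /negP h; apply: hn; exists i.
by rewrite /bump (bigD1 i)//= rescale_supp ?mul0r.
Qed.

Lemma bump_continuous m : continuous (bump m).
Proof.
move=> x; apply: (@cvg_big R 'I_N *%R 1 xpredT (@mul_continuous R) V (nbhs x)) => i _.
apply: (@continuous_comp _ _ _ (fun x : V => x ord0 i)).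
  exact: coord_continuous.
exact: (tower_continuous rescale_tower).
Qed.

Lemma bump_cvg_partial m j x :
  h^-1 *: ((bump m \o shift x) (h *: delta_mx ord0 j) - bump m x) @[h --> 0^']
    --> bump (incr_at m j) x.
Proof.
pose P := \prod_(i < N | i != j) rescale (m i) (x ord0 i).
have -> : bump (incr_at m j) x = P * rescale (m j).+1 (x ord0 j).
  rewrite /bump (bigD1 j)//= /incr_at eqxx mulrC; congr (_ * _).
  by apply: eq_bigr => i /negbTE ->.
rewrite (_ : (fun h => _) = fun h : R => P * (h^-1 *:
    ((rescale (m j) \o shift (x ord0 j)) (h *: (1 : R)) - rescale (m j) (x ord0 j)))).
  have d := rescale_tower (m j) (x ord0 j).
  apply: cvgM; first exact: cvg_cst.
  rewrite -(@derive_val _ _ _ _ _ _ _ d); exact: (@ex_derive _ _ _ _ _ _ _ d).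
apply/funext => h; rewrite /bump /shift /= (bigD1 j)//= [X in _ - X](bigD1 j)//=.
rewrite !mxE !eqxx mulr1 [h%:A]mulr1 (eq_bigr (fun i => rescale (m i) (x ord0 i))).
  by rewrite -mulrBl /GRing.scale/= [RHS]mulrC mulrA.
by move=> i /negbTE ij; rewrite !mxE ij andbF mulr0 add0r.
Qed.

Lemma bump_derivable m j x : derivable (bump m) x (delta_mx ord0 j).
Proof. by apply/cvg_ex; exists (bump (incr_at m j) x); exact: bump_cvg_partial. Qed.

Lemma bump_partial m j x : partial j (bump m) x = bump (incr_at m j) x.
Proof. by apply: cvg_lim => //; exact: bump_cvg_partial. Qed.

Lemma bump_smooth m : smooth (bump m).
Proof.
move=> k; elim: k m => [|k IH] m; first exact: bump_continuous.
split; [exact: bump_continuous|by move=> i x; exact: bump_derivable|].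
move=> i; have -> : partial i (bump m) = bump (incr_at m i).
  by apply/funext => x; exact: bump_partial.
exact: IH.
Qed.

Lemma bump_test_function m (Om : set V) : box a (a + r) `<=` Om ->
  test_function Om (bump m).
Proof.
have cl : closure [set x | bump m x != 0] `<=` box a (a + r).
  have cb : closed (@box R N a (a + r)).
    by apply: compact_closed; [exact: norm_hausdorff|exact: compact_box].
  move/closure_id: cb => ->; apply: closure_subset.
  by move=> x /eqP hx; apply: contrapT => /(bump_supp m).
move=> bOm; split; first exact: bump_smooth.
  apply: (subclosed_compact _ (@compact_box R N a (a + r)) cl); exact: closed_closure.
exact: subset_trans bOm.
Qed.

Let aar : a <= a + r. Proof. by rewrite lerDl ltW. Qed.

Lemma bump_weak_partial (Om : set V) p m i : 1 < p -> box a (a + r) `<=` Om ->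
  weak_partial Om p i (bump m) (bump (incr_at m i)).
Proof.
move=> p1 bOm; apply: (weak_partial_supported p1 aar bOm).
- exact: bump_continuous.
- exact: bump_continuous.
- by move=> x; exact: bump_derivable.
- by move=> x; exact: bump_partial.
- exact: bump_supp.
- exact: bump_supp.
Qed.

(** The bump is its own approximation by test functions, and it vanishes on the
    boundary since its support lies in the open set [Om]. *)
Lemma bump_trace (Om : set V) p m : 1 < p -> open Om -> box a (a + r) `<=` Om ->
  trace Om p (bump m) (fun=> 0).
Proof.
move=> p1 oOm bOm.
have p1' : (1 <= p%:E :> \bar R)%E by rewrite lee_fin ltW.
have bd x : boundary Om x -> bump m x = 0.
  move=> [_ nint]; apply: bump_supp => /bOm xOm; apply: nint.
  exact: open_nbhs_nbhs.
exists (fun=> bump m), (fun i => bump (incr_at m i)); split.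
- rewrite (_ : _ \_ _ = 0).
    by have [] := Lfun_submod_closed (@surface_measure R N) p1'.
  by apply/funext => x; rewrite /patch; case: ifP.
- by move=> i; exact: bump_weak_partial.
- by move=> _; apply: bump_test_function => x _.
split.
- under eq_fun do (under [X in normLp _ _ X]eq_fun do rewrite subrr).
  by rewrite normLp0//; exact: cvg_cst.
- move=> i; under eq_fun do
    (under [X in normLp _ _ X]eq_fun do rewrite bump_partial subrr).
  by rewrite normLp0//; exact: cvg_cst.
- rewrite (_ : (_ \_ _) = cst 0).
    by rewrite Lnorm0; [exact: cvg_cst|rewrite gt_eqF// lte_fin (lt_trans ltr01)].
  apply/funext => x; rewrite /patch; case: ifPn => // /set_mem /bd ->.
  by rewrite subrr.
Qed.

(** The traces of a bump and of its gradient vanish, so that the boundary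
    condition holds whatever [theta] is. *)
Lemma bump_theta_laplacian alpha (Om : set V) p theta m : 1 < p -> open Om ->
  holder_domain 2 alpha Om -> box a (a + r) `<=` Om ->
  theta_laplacian Om p theta (bump m)
    (fun x => \sum_i bump (incr_at (incr_at m i) i) x).
Proof.
move=> p1 oOm hd bOm; have wp m' i := bump_weak_partial m' i p1 bOm.
have LpW m' : Lp Om p (bump m').
  have [M bM] := boxed_of_continuous (@bump_continuous m') (@bump_supp m').
  by have [] := Lp_boxed p1 aar bOm bM.
split.
- split=> // i; exists (bump (incr_at m i)) => //; split => // j.
  by exists (bump (incr_at (incr_at m i) j)); [exact: wp|exact: LpW].
- have [n hn] := outward_normal_exists hd.
  exists n, (fun=> 0), (fun=> (fun=> 0)); split => //.
  + exact: bump_trace.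
  + by move=> i; exists (bump (incr_at m i)) => //; exact: bump_trace.
  + apply: aeW => x _; rewrite mulr0 addr0 big1 ?mulr0// => i _; exact: mulr0.
- exists (fun i => bump (incr_at m i)), (fun i => bump (incr_at (incr_at m i) i)).
  by split => //; apply: aeW.
Qed.

End product_bumps.

(** * Wave packets and the theorem *)

Section packet_estimates.
Context (R : realType) (N : nat) (F : nat -> R -> R) (a r : R).
Context (F_tower : derivative_tower F)
  (F_supp : forall k t, t \notin `[0, 1] -> F k t = 0).
Context (F01 : forall t, 0 <= F 0%N t <= 1).
Context (r0 : 0 < r).
Local Notation V := 'rV[R]_N.
Local Notation u := (@bump R N F a r (fun=> 0%N)).
Local Notation lap := (fun x : V =>
  \sum_i @bump R N F a r (incr_at (incr_at (fun=> 0%N) i) i) x).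

Lemma rescale0E t : rescale F a r 0 t = F 0%N (r^-1 * t + - (a / r)).
Proof. by rewrite /rescale expr0 mul1r. Qed.

Lemma bump01 x : 0 <= u x <= 1.
Proof.
rewrite /bump; apply/andP; split.
  by apply: prodr_ge0 => i _; rewrite rescale0E;
    have /andP[] := F01 (r^-1 * x ord0 i + - (a / r)).
by apply: prodr_ile1 => i _; rewrite rescale0E F01.
Qed.

Lemma bump_ge c x : 0 <= c -> (forall t, 4^-1 <= t <= 3 / 4 -> c <= F 0%N t) ->
  box (a + r / 4) (a + 3 * r / 4) x -> c ^+ N <= u x.
Proof.
move=> c0 hc bx; rewrite /bump -[X in c ^+ X]card_ord -prodr_const.
apply: ler_prod => i _; rewrite c0 rescale0E; apply: hc.
have E t : r^-1 * t + - (a / r) = (t - a) / r by field; rewrite gt_eqF.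
have := bx i; rewrite in_itv/= => /andP[h1 h2]; rewrite E.
rewrite ler_pdivlMr// ler_pdivrMr//; move: h1 h2; lra.
Qed.

(** One factor of each term is a second derivative, of size [r ^- 2]; the other
    factors are at most 1. *)
Lemma laplacian_bound K M x : (forall t, `|F 2 t| <= K) ->
  N%:R * (r^-1 ^+ 2 * K) <= M -> `|lap x| <= M.
Proof.
move=> FK; apply: le_trans.
apply: (le_trans (ler_norm_sum _ _ _)).
rewrite mulr_natl -[X in _ *+ X]card_ord -sumr_const; apply: ler_sum => i _.
rewrite /bump (bigD1 i)//= normrM -[leRHS]mulr1; apply: ler_pM => //.
  have rk0 : 0 <= r^-1 ^+ 2 by rewrite exprn_ge0// invr_ge0 ltW.
  rewrite /incr_at !eqxx /rescale normrM (ger0_norm rk0).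
  exact: ler_wpM2l.
rewrite normr_prod; apply: prodr_ile1 => j /negbTE ji.
rewrite normr_ge0/= /incr_at ji rescale0E.
by have /andP[h1 h2] := F01 (r^-1 * x ord0 j + - (a / r)); rewrite ger0_norm.
Qed.

End packet_estimates.

(** The choice of the scale. The bump is at least [c ^+ N] on a cube of side
    [r / 2] and its Laplacian is at most [M] on a cube of side [r]; the lower
    bound on its norm must reach 1, for the normalised bump to remain at most
    1, and must be at least [2 * T] times the bound on the norm of its
    Laplacian. *)
Lemma packet_scales (R : realType) (N : nat) (p c K T : R) :
  1 < p -> 0 < c -> 0 <= K -> 0 < T ->
  exists r M : R, [/\ 0 < r, N%:R * (r^-1 ^+ 2 * K) <= M,
    1 <= ((c ^+ N) `^ p * (r / 2) ^+ N) `^ p^-1 &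
    T * (M `^ p * r ^+ N) `^ p^-1 <=
      2^-1 * ((c ^+ N) `^ p * (r / 2) ^+ N) `^ p^-1].
Proof.
move=> p_gt1 c0 K0 T0; have p0 : 0 < p by apply: lt_trans p_gt1.
have cN0 : 0 < c ^+ N by rewrite exprn_gt0.
have cp0 : 0 < c `^ p by rewrite powR_gt0.
have T2 : 0 < 2 * T by rewrite mulr_gt0.
pose d : R := 2^-1 ^+ N.
have d0 : 0 < d by rewrite exprn_gt0// invr_gt0.
have d1 : d <= 1 by rewrite exprn_ile1// ?invr_ge0// invf_le1// ler1n.
(* Raised to the power p, the factor [d] compensates the ratio of the volumes of
   the two cubes, since [d `^ p <= d]. *)
pose M := c ^+ N * d * (2 * T)^-1.
have M0 : 0 < M by rewrite !mulr_gt0// invr_gt0.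
pose r := 1 + (2 / c `^ p + N%:R * K / M).
have x1 : 0 <= 2 / c `^ p by rewrite divr_ge0 ?(ltW cp0).
have x2 : 0 <= N%:R * K / M by apply: divr_ge0; [exact: mulr_ge0|exact: ltW].
have r1 : 1 <= r by rewrite /r lerDl addr_ge0.
have r0 : 0 < r by apply: lt_le_trans r1.
exists r, M; split => //.
- have -> : N%:R * (r^-1 ^+ 2 * K) = (N%:R * K) / r ^+ 2.
    by field; rewrite gt_eqF.
  rewrite ler_pdivrMr ?exprn_gt0// [leRHS]mulrC -ler_pdivrMr//.
  apply: (@le_trans _ _ r); first by rewrite /r addrA lerDr addr_ge0.
  by rewrite expr2 ler_peMr// ltW.
- rewrite -[leLHS](_ : 1 `^ p^-1 = 1); last by rewrite powR1.
  have A1 : 1 <= (c ^+ N) `^ p * (r / 2) ^+ N.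
    rewrite (_ : (c ^+ N) `^ p = (c `^ p) ^+ N); last first.
      by rewrite -[RHS]powR_mulrn ?powR_ge0// -powRrM mulrC powRrM powR_mulrn// ltW.
    rewrite -exprMn exprn_ege1// mulrA ler_pdivlMr// mul1r.
    by rewrite -ler_pdivrMl// mulrC /r addrCA lerDl addr_ge0.
  rewrite ge0_ler_powR ?nnegrE ?invr_ge0 ?(ltW p0)//.
  exact: le_trans A1.
- have E : ((2 * T)^-1 `^ p) `^ p^-1 = (2 * T)^-1.
    by rewrite -powRrM mulfV ?powRr1 ?invr_ge0 ?(ltW T2)// gt_eqF.
  have cd0 : 0 <= c ^+ N * d by rewrite ltW// mulr_gt0.
  have rN0 : 0 <= r ^+ N by rewrite exprn_ge0// ltW.
  have -> : M `^ p * r ^+ N = ((c ^+ N * d) `^ p * r ^+ N) * (2 * T)^-1 `^ p.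
    by rewrite /M powRM ?invr_ge0 ?(ltW T2)// mulrAC.
  rewrite powRM ?mulr_ge0 ?powR_ge0// E mulrCA.
  have -> : T / (2 * T) = 2^-1 by field; rewrite gt_eqF.
  rewrite mulrC ler_wpM2l ?invr_ge0//.
  rewrite ge0_ler_powR ?nnegrE ?invr_ge0 ?(ltW p0) ?mulr_ge0 ?powR_ge0//.
    by rewrite exprn_ge0// divr_ge0// ltW.
  rewrite powRM ?(ltW d0) ?(ltW cN0)// -mulrA exprMn ler_wpM2l ?powR_ge0//.
  rewrite [leRHS]mulrC ler_wpM2r// ge1r_powR ?d0 ?d1//; exact: ltW.
Qed.

Section packets.
Context (R : realType) (N : nat) (Om : set 'rV[R]_N) (p : R) (p_gt1 : 1 < p).
Local Notation V := 'rV[R]_N.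
Local Notation Lp := (Lp Om p).
Local Notation normLp := (normLp Om p).

Context (S : R -> (V -> R) -> V -> R) (hS : C0_contraction_semigroup Om p S).
Context (alpha : R) (theta : V -> R).

(** At the scale given by [packet_scales], the drift up to time [T] is at most
    half of the norm. *)
Lemma wave_packets (a : R) (T : R) : open Om -> holder_domain 2 alpha Om ->
  (forall b, box a b `<=` Om) ->
  generated_by Om p S (theta_laplacian Om p theta) -> 0 < T ->
  exists u, [/\ Lp u, forall x, 0 <= u x <= 1, normLp u = 1%E &
    ((2^-1)%:E <= normLp (S T u))%E].
Proof.
move=> oOm hd bOm gen T0.
have [F [Ft F01 [c c0 cF] Fs]] := smooth_bump R.
have [K K0 FK] := tower_bounded Ft (Fs 2).
have [r [M [r0 KM one small]]] := packet_scales N p_gt1 c0 K0 T0.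
pose m0 := fun _ : 'I_N => 0%N.
pose u := @bump R N F a r m0.
pose f := fun x : V => \sum_i @bump R N F a r (incr_at (incr_at m0 i) i) x.
have aar : a <= a + r by rewrite lerDl ltW.
have bO := bOm (a + r).
have uc : continuous u by exact: bump_continuous.
have us x : ~ box a (a + r) x -> u x = 0 by exact: bump_supp.
have fc : continuous f.
  move=> x; apply: (@cvg_big R 'I_N +%R 0 xpredT (@add_continuous R) V (nbhs x)).
  by move=> i _; exact: bump_continuous.
have fM : boxed a (a + r) M f.
  split.
  - exact: continuous_measurable_rV.
  - by move=> x; apply: laplacian_bound KM.
  - by move=> x hx; rewrite /f big1// => i _; exact: bump_supp.
have [Mu bu] := boxed_of_continuous uc us.
have [uLp _] := Lp_boxed p_gt1 aar bO bu.
have [fLp fle] := Lp_boxed p_gt1 aar bO fM.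
have uge : ((((c ^+ N) `^ p * (r / 2) ^+ N) `^ p^-1)%:E <= normLp u)%E.
  have ab' : a + r / 4 <= a + 3 * r / 4 by lra.
  have := normLp_ge_box p_gt1 bO bu ab' (exprn_ge0 N (ltW c0)) _.
  rewrite poweR_EFin (_ : a + 3 * r / 4 - (a + r / 4) = r / 2); last by field.
  by apply => x; apply: bump_ge => //; exact: ltW.
have drift : (normLp u <= normLp (S T u) + T%:E * normLp f)%E.
  apply: (norm_semigroup_ge p_gt1 hS uLp fLp (ltW T0)).
  by apply/(gen u f uLp fLp); exact: bump_theta_laplacian hd bO.
have STu := semigroup_Lp hS (ltW T0) uLp.
move: uge fle drift; rewrite poweR_EFin [a + r - a]addrC addKr.
rewrite -(fineK (normLp_fin uLp)) -(fineK (normLp_fin fLp)) -(fineK (normLp_fin STu)).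
rewrite -EFinM -EFinD !lee_fin.
set n := fine (normLp u) => un fn drift.
have n1 : 1 <= n by exact: le_trans un.
have n0 : 0 < n by apply: lt_le_trans n1.
have half : 2^-1 * n <= fine (normLp (S T u)).
  have : T * fine (normLp f) <= 2^-1 * n.
    apply: (le_trans (ler_wpM2l (ltW T0) fn)); apply: (le_trans small).
    by rewrite ler_wpM2l.
  move: drift; move: (fine _) (T * _) => A B; lra.
have nE : normLp u = n%:E by rewrite /n fineK// normLp_fin.
have nV : 0 < n^-1 by rewrite invr_gt0.
exists (fun x => n^-1 * u x); split.
- exact: LpZ.
- move=> x; have /andP[u0 u1] := @bump01 _ N _ a r F01 x.
  rewrite mulr_ge0 ?(ltW nV)//= -ler_pdivlMl// invrK mulr1.
  exact: le_trans n1.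
- by rewrite normLpZ// gtr0_norm// nE -EFinM mulVf// gt_eqF.
- rewrite (norm_semigroupZ p_gt1 hS)//; last exact: ltW.
  by rewrite gtr0_norm// -(fineK (normLp_fin STu)) -EFinM lee_fin ler_pdivlMl// mulrC.
Qed.

End packets.

Theorem lemma5p3 (R : realType) (N : nat) (N_gt0 : (0 < N)%N)
  (alpha : R) (alpha01 : 0 < alpha < 1)
  (hole : set 'rV[R]_N) (hole_ext : exterior_domain alpha hole)
  (theta : 'rV[R]_N -> R) (theta_ok : theta_datum alpha (~` hole) theta)
  (p : R) (p_gt1 : 1 < p)
  (S : R -> ('rV[R]_N -> R) -> ('rV[R]_N -> R))
  (S_theta : theta_semigroup (~` hole) p theta S)
  (g : R -> R) (g_cont : {within `[0, +oo[, continuous g})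
  (g_lim : g t @[t --> +oo] --> 0) :
  exists (u0 : 'rV[R]_N -> R) (T : R),
    [/\ Lp (~` hole) p u0,
        forall x, (~` hole) x -> 0 <= u0 x,
        normLp (~` hole) p u0 = 1%E,
        0 < T &
        forall t, T <= t -> ((g t)%:E <= normLp (~` hole) p (S t u0))%E].
Proof.
have [hcompact _ _ _ hd] := hole_ext.
have [hS _ gen hk] := S_theta.
have oOm : open (~` hole).
  by apply: closed_openC; apply: compact_closed => //; exact: norm_hausdorff.
pose i0 : 'I_N := Ordinal N_gt0.
have [a ha] : exists a : R, forall b, box a b `<=` ~` hole.
  have : bounded_set ((fun x : 'rV[R]_N => x ord0 i0) @` hole).
    apply: compact_bounded; apply: continuous_compact => //.
    by apply: continuous_subspaceT; exact: coord_continuous.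
  (* One coordinate suffices to separate the cubes from the bounded hole. *)
  case=> M [_ hM]; exists (M + 2) => b x /(_ i0) + hx.
  rewrite in_itv/= => /andP[+ _].
  have : `|x ord0 i0| <= M + 1 by apply: hM; [rewrite ltrDl|exists x].
  rewrite ler_norml => /andP[_]; lra.
apply: (slow_decay p_gt1 hS hk) => // T T0.
exact: (wave_packets p_gt1 hS oOm hd ha gen T0).
Qed.
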